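(* Consider the cancel-on-completion (c.o.c.) variant of the fork-join$(n_{\mathrm F},n_{\mathrm J})$ model on $N$ servers with the LCFS-PR discipline, in steady state, where $1\le n_{\mathrm J}\le n_{\mathrm F}\le N$, and assume $\rho_{\mathrm U}:=\mathbb{E}[B_{(n_{\mathrm J})}]/\mathbb{E}[A]<1$. If $B_{(n_{\mathrm J})}\in RV(-\tilde\nu)$, then the steady-state response time satisfies $R\in ORV(-\tilde\nu)$.
   Context: Model. There are $N$ parallel unit-speed servers, each using the last-come first-served preemptive-resume (LCFS-PR) discipline. Jobs arrive at the epochs of a renewal process with i.i.d. interarrival times distributed as $A$, with finite mean. On arrival of a job, replicas of it are assigned to $n_{\mathrm F}$ distinct servers chosen uniformly at random. The replica sizes $(B_1,\dots,B_{n_{\mathrm F}})$ of a job have some joint distribution, with each $B_i$ distributed as $B$ but not necessarily independent of each other; the vectors for different jobs are i.i.d. and independent of arrivals and server choices. In the c.o.c. variant, as soon as $n_{\mathrm J}$ of the $n_{\mathrm F}$ replicas of a job have finished service, its remaining replicas are abandoned and the job is completed. $R$ is the steady-state response time of a job: the time from its arrival to its completion. $B_{(n_{\mathrm J})}$ is the $n_{\mathrm J}$-th order statistic ($n_{\mathrm J}$-th smallest) of $B_1,\dots,B_{n_{\mathrm F}}$. $X\in RV(-\nu)$ means $\mathbb{P}(X>x)=L(x)x^{-\nu}$ for $x>0$, where $L$ is slowly varying: $L(\alpha x)/L(x)\to1$ as $x\to\infty$ for every $\alpha>0$. $X\in ORV(-\nu)$ means that there are positive constants $c_1,c_2$ such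 that, with $\bar F(x)=\mathbb{P}(X>x)$, for all $\alpha\ge1$, $$c_1\alpha^{-\nu}<\liminf_{x\to\infty}\frac{\bar F(\alpha x)}{\bar F(x)}\le\limsup_{x\to\infty}\frac{\bar F(\alpha x)}{\bar F(x)}<c_2\alpha^{-\nu}.$$ *)

(* Defs.v *)
From HB Require Import structures.
From mathcomp Require Import all_boot all_order all_algebra.
From mathcomp Require Import all_classical all_reals all_analysis.
From mathcomp Require Import measurable_realfun lebesgue_measure.

Set Implicit Arguments.
Unset Strict Implicit.
Unset Printing Implicit Defensive.

Import Order.TTheory GRing.Theory Num.Theory.
Import numFieldNormedType.Exports.

Local Open Scope classical_set_scope.
Local Open Scope ring_scope.

Definition tail d (T : measurableType d) (R : realType) (P : probability T R)
    (X : T -> \bar R) (x : R) : R :=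
  fine (P [set w | (x%:E < X w)%E]).

Definition slowly_varying (R : realType) (L : R -> R) : Prop :=
  forall alpha : R, 0 < alpha -> L (alpha * x) / L x @[x --> +oo] --> (1 : R).

(* X \in RV(rho).  As [y / 0 = 0] here, slow variation forces [L], hence the
   tail, to be eventually nonzero. *)
Definition regularly_varying d (T : measurableType d) (R : realType)
    (P : probability T R) (X : T -> \bar R) (rho : R) : Prop :=
  exists2 L : R -> R, slowly_varying L &
    forall x : R, 0 < x -> tail P X x = L x * x `^ rho.

(* X \in ORV(rho) *)
Definition O_regularly_varying d (T : measurableType d) (R : realType)
    (P : probability T R) (X : T -> \bar R) (rho : R) : Prop :=
  exists c1 c2 : R, [/\ 0 < c1, 0 < c2 &
    forall alpha : R, 1 <= alpha ->
      let ratio (x : R) := (tail P X (alpha * x) / tail P X x)%:E in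
      [/\ ((c1 * alpha `^ rho)%:E < limf_einf ratio (+oo%R : set_system R))%E,
          (limf_einf ratio (+oo%R : set_system R) <=
           limf_esup ratio (+oo%R : set_system R))%E &
          (limf_esup ratio (+oo%R : set_system R) < (c2 * alpha `^ rho)%:E)%E]].

(* Values +oo are allowed, so the limit is taken among laws on the extended
   reals and tightness is not presupposed. *)
Definition converges_in_distribution (R : realType)
    d (T : measurableType d) (P : probability T R) (X : nat -> T -> \bar R)
    d' (T' : measurableType d') (Q : probability T' R) (Y : T' -> \bar R) :
    Prop :=
  forall x : R, {for x, continuous (tail Q Y)} ->
    tail P (X k) x @[k --> \oo] --> tail Q Y x.

Definition mutually_independent d (T : measurableType d) (R : realType)
    (P : probability T R) (I : eqType) (F : I -> set_system T) : Prop :=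
  (forall i, F i `<=` measurable) /\
  forall (J : seq I) (E : I -> set T), uniq J ->
    (forall i, i \in J -> F i (E i)) ->
    P (\big[setI/setT]_(i <- J) E i) = (\prod_(i <- J) P (E i))%E.

(* r-th smallest entry, r >= 1 *)
Definition order_stat (R : realType) (r : nat) (b : seq R) : R :=
  nth 0 (sort <=%R b) r.-1.

Section fork_join.
Context {d : measure_display} {Omega : measurableType d} {R : realType}.
Variables (P : probability Omega R) (N nF nJ : nat).

(* A k : k-th interarrival time; s k w i : the server receiving replica i of
   job k; B k : the vector of replica sizes of job k *)
Variables (A : nat -> {RV P >-> R})
          (s : nat -> Omega -> {ffun 'I_nF -> 'I_N})
          (B : nat -> {RV P >-> (nF.-tuple R)}).

Definition input_sigma (i : nat + nat + nat) : set_system Omega :=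
  match i with
  | inl (inl k) => preimage_set_system setT (A k) measurable
  | inl (inr k) => preimage_set_system setT (s k) setT
  | inr k => preimage_set_system setT (B k) measurable
  end.

Record fork_join_input : Prop := {
  input_indep : mutually_independent P input_sigma;
  interarrival_ge0 : forall k w, 0 <= A k w;
  interarrival_id : forall k (V : set R), measurable V ->
    distribution P (A k) V = distribution P (A 0%N) V;
  (* uniform over the N ^_ nF injective assignments *)
  server_choice : forall k (f : {ffun 'I_nF -> 'I_N}),
    P (s k @^-1` [set f]) = ((injectiveb f)%:R / (N ^_ nF)%:R)%:E;
  size_ge0 : forall k w i, 0 <= tnth (B k w) i;
  size_id : forall k (V : set (nF.-tuple R)), measurable V ->
    distribution P (B k) V = distribution P (B 0%N) V;
  size_marginals : forall k i j (V : set R), measurable V ->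
    P [set w | V (tnth (B k w) i)] = P [set w | V (tnth (B k w) j)] }.

Definition arrival_epoch (k : nat) (w : Omega) : R := \sum_(j < k.+1) A j w.

(* Since interarrival times may vanish, simultaneous arrivals are ordered by
   job index. *)
Section sample_path.
Variables (T : nat -> R) (sv : nat -> {ffun 'I_nF -> 'I_N})
          (b : nat -> nF.-tuple R).
(* D k : completion epoch of job k; W k i t : service received up to time t by
   replica i of job k *)
Variables (D : nat -> \bar R) (W : nat -> 'I_nF -> R -> R).

Definition present (k : nat) (i : 'I_nF) (t : R) : Prop :=
  [/\ T k <= t, (t%:E < D k)%E & W k i t < tnth (b k) i].

Definition in_service (k : nat) (i : 'I_nF) (t : R) : Prop :=
  present k i t /\
  forall (l : nat) (j : 'I_nF), (k < l)%N -> sv l j = sv k i ->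
    ~ present l j t.

(* Unit-speed service: the service received is the time spent in service. *)
Definition attained_service : Prop :=
  forall k i t,
    lebesgue_measure [set u : R | u <= t /\ in_service k i u] =
    (W k i t)%:E.

Definition completion : Prop :=
  forall k, D k = ereal_inf [set t%:E | t in
    [set t : R | T k <= t /\
                 (nJ <= #|[pred i | (tnth (b k) i <= W k i t)%R]|)%N]].

End sample_path.

(* The system starts empty.  As T is nondecreasing and a.s. tends to +oo, the
   two fixed-point equations determine W and D, forward in time. *)
Definition coc_lcfs_pr (T : nat -> R) (sv : nat -> {ffun 'I_nF -> 'I_N})
    (b : nat -> nF.-tuple R) (D : nat -> \bar R) : Prop :=
  exists W : nat -> 'I_nF -> R -> R,
    attained_service T sv b D W /\ completion T b D W.

Definition coc_fork_join_lcfs (D : nat -> {RV P >-> \bar R}) : Prop :=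
  {ae P, forall w,
    coc_lcfs_pr (arrival_epoch ^~ w) (s ^~ w) (fun k => B k w) (fun k => D k w)}.

Definition response_time (D : nat -> {RV P >-> \bar R}) (k : nat) (w : Omega) :
    \bar R :=
  (D k w - (arrival_epoch k w)%:E)%E.

Definition order_stat_size (k : nat) (w : Omega) : R := order_stat nJ (B k w).

(* Division in \bar R, where 0^-1 = +oo. *)
Definition rho_U : \bar R := ('E_P[order_stat_size 0%N] / 'E_P[A 0%N])%E.

End fork_join.

(* Main.v *)
Require Import Defs.
From mathcomp Require Import all_boot all_order all_algebra.
From mathcomp Require Import all_classical all_reals all_analysis.
From mathcomp Require Import measurable_realfun lebesgue_measure.
From mathcomp Require Import zify ring lra.
Import Order.TTheory GRing.Theory Num.Theory.
Import numFieldNormedType.Exports.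

Set Implicit Arguments.
Unset Strict Implicit.
Unset Printing Implicit Defensive.

Local Open Scope classical_set_scope.
Local Open Scope ring_scope.

(** Write [beta k] for the [nJ]-th order statistic of the replica sizes of job
    [k], and [F] for its tail.  The response time of job [k] is squeezed between
    [beta k] and a busy period of a single-server queue with service times
    [beta], and both have tails of the order of [F]; regular variation of [F]
    then gives the two bounds of O-regular variation.

    Lower bound ([completion_ge], [tail_response_ge]): replicas are served at
    speed at most one, so [nJ] of them cannot be finished before age [beta k].

    Upper bound, on a sample path ([latest_le], [busy_period]): at each time at
    which job [k] is incomplete, consider the most recent incomplete job.  By
    preemption all its unfinished replicas are in service simultaneously, hence
    job [m] can play this part only for a total time [beta m].  As long as job
    [k] stays in the system, the elapsed time is therefore at most the sum of
    the [beta]'s of the jobs arrived meanwhile.  After bounding the interarrival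
    times by a constant [M], chosen so large that the truncated mean still
    exceeds the mean of [beta], a response time above [n * M] forces the random
    walk with steps [beta - min(A, M)] to stay nonnegative for [n] steps.

    Such a walk has negative drift, and it remains to show that it stays
    nonnegative for [n] steps with probability at most [C * F n]
    ([survival_dominated]).  This is the principle of one big jump, in a form
    that needs nothing beyond a finite mean ([survival_step]): stop the walk
    when it first exceeds [delta * n], or at half time.  Either the stopping
    step is larger than [delta * n]; as the expected number of steps before
    leaving the half-line is bounded, this costs a constant times
    [F (delta * n)].  Or the walk is below [2 * delta * n] at the stopping time,
    and has to stay nonnegative for [n / 2] further steps against its drift,
    which by the weak law of large numbers ([survival_lln]) has a probability
    [q] that tends to zero.  In the second case the walk has already survived a
    fixed fraction of [n] steps, because its downward steps are bounded.  Hence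
    [p n <= q * p (n / r) + c * F (delta * n)] for the survival probability [p],
    and the bound follows by induction on [n], the ratio [F (n / r) / F n] being
    bounded.

    To keep this elementary the steps are rounded to a finite grid, in the
    direction that enlarges the walk.  Survival probabilities are then finite
    sums, and the independence of the input is only used for cylinders
    ([stay_le_survival], [cell_iid]).  Finally, the law of the stationary
    response time is a limit at the continuity points of its tail; these meet
    every interval ([nonincreasing_continuity_point]), and monotonicity together
    with regular variation of [F] carries the bounds to all large arguments. *)

(** * Random walks with finitely many step values *)

Section finite_walk.
Context {R : realType} {I : finType}.
Variables (w X : I -> R).
Hypotheses (w_ge0 : forall i, 0 <= w i) (w_sum1 : \sum_i w i = 1).

(** Backward equation for the probability that the walk started at [s], whose
    steps are i.i.d. with value [X i] of weight [w i], is nonnegative at the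
    times [0, .., n]. *)
Fixpoint survival (n : nat) (s : R) : R :=
  if 0 <= s then
    if n is n'.+1 then \sum_i w i * survival n' (s + X i) else 1
  else 0.

Definition mean (f : I -> R) := \sum_i w i * f i.

Let mean_le (f g : I -> R) : (forall i, f i <= g i) -> mean f <= mean g.
Proof. by move=> fg; apply: ler_sum => i _; rewrite ler_wpM2l. Qed.

Let mean_cst (c : R) : mean (fun=> c) = c.
Proof. by rewrite /mean -mulr_suml w_sum1 mul1r. Qed.

Let meanD (f g : I -> R) : mean (fun i => f i + g i) = mean f + mean g.
Proof. by rewrite /mean -big_split; apply: eq_bigr => i _; rewrite mulrDr. Qed.

Let meanZ (c : R) (f : I -> R) : mean (fun i => c * f i) = c * mean f.
Proof. by rewrite /mean mulr_sumr; apply: eq_bigr => i _; rewrite mulrCA. Qed.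

Lemma survival_neg n (s : R) : s < 0 -> survival n s = 0.
Proof. by rewrite ltNge => /negbTE; case: n => [|n] /= ->. Qed.

Lemma survivalS n (s : R) :
  0 <= s -> survival n.+1 s = \sum_i w i * survival n (s + X i).
Proof. by move=> /= ->. Qed.

Lemma survival_itv n (s : R) : 0 <= survival n s <= 1.
Proof.
elim: n s => [|n IHn] s /=; case: ifP => _; rewrite ?lexx ?ler01 //.
apply/andP; split; first by apply: sumr_ge0 => i _; rewrite mulr_ge0 //; case/andP: (IHn (s + X i)).
rewrite -[leRHS](mean_cst 1); apply: mean_le => i; by case/andP: (IHn (s + X i)).
Qed.

Let surv_ge0 n (s : R) : 0 <= survival n s. Proof. by case/andP: (survival_itv n s). Qed.
Let surv_le1 n (s : R) : survival n s <= 1. Proof. by case/andP: (survival_itv n s). Qed.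

Lemma survival_leS n (s : R) : survival n.+1 s <= survival n s.
Proof.
elim: n s => [|n IHn] s.
  have [s0|s0] := ltP s 0; first by rewrite !survival_neg.
  by rewrite [leRHS]/= s0; exact: surv_le1.
have [s0|s0] := ltP s 0; first by rewrite !survival_neg.
by rewrite survivalS // [leRHS]survivalS //; exact: mean_le.
Qed.

Lemma survival_le m n (s : R) : (m <= n)%N -> survival n s <= survival m s.
Proof.
move=> /subnKC <-; elim: (n - m)%N => [|k IHk]; first by rewrite addn0.
by rewrite addnS; apply: le_trans (survival_leS _ _) IHk.
Qed.

Variables (M : R).
Hypotheses (M_ge0 : 0 <= M) (X_ge : forall i, - M <= X i).

Lemma survival1 n (s : R) : n%:R * M <= s -> survival n s = 1.
Proof.
elim: n s => [|n IHn] s hs /=; first by rewrite mul0r in hs; rewrite hs.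
have nM : 0 <= n%:R * M by rewrite mulr_ge0.
have {}hs : n%:R * M + M <= s by move: hs; rewrite -natr1 mulrDl mul1r.
have -> : 0 <= s by have := M_ge0; lra.
rewrite -[RHS](mean_cst 1); apply: eq_bigr => i _; rewrite IHn//.
by have := X_ge i; lra.
Qed.

(** One big jump.  The walk is observed until it exceeds [H], or for [j] steps.
    If the step over [H] is itself larger than [H], its cost is [g]; the factor
    [(s + M) / mu] bounds the expected number of steps before the walk becomes
    negative, since the drift takes away [mu] per step and the walk is never
    below [- M] at that moment.  Otherwise the walk stops below [2 * H] and
    survives [m] more steps with probability at most [q]; when it has exceeded
    [H] it can no longer become negative within [l] steps, so in all cases this
    event is contained in the survival of [l] steps.  The induction on [j]
    conditions on the first step. *)
Lemma survival_step (mu : R) (H q g : R) (m l j : nat) (s : R) :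
  0 < mu -> 0 <= H -> 0 <= q -> mean X <= - mu ->
  (forall t, t < 2 * H -> survival m t <= q) ->
  \sum_i w i * (H < X i)%R%:R <= g ->
  (l <= j)%N -> l%:R * M <= H -> 0 <= s < H ->
  survival (j + m) s <= q * survival l s + g * (s + M) / mu.
Proof.
move=> mu0 H0 q0 EX hq hg; have M0 := M_ge0.
have g0 : 0 <= g by apply: le_trans hg; apply: sumr_ge0 => i _; rewrite mulr_ge0.
elim: j l s => [|j IHj] l s lj lM /andP[s0 sH].
  move: lj; rewrite leqn0 => /eqP ->; rewrite add0n /= s0 mulr1.
  apply: ler_wpDr; last by apply: hq; lra.
  by rewrite divr_ge0 ?(ltW mu0)// mulr_ge0//; lra.
suff step (l' : nat) : (l' <= j)%N -> l'%:R * M <= H ->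
    survival (j.+1 + m) s <= q * survival l'.+1 s + g * (s + M) / mu.
  case: l lj lM => [|l'] lj lM.
    apply: le_trans (step 0%N isT _) _; first by rewrite mul0r.
    by rewrite lerD2r ler_wpM2l// survival_leS.
  apply: step => //; apply: le_trans lM.
  by rewrite ler_wpM2r// ler_nat.
move=> l'j l'M.
rewrite addSn survivalS// [survival l'.+1 _]survivalS//.
have pt i : survival (j + m) (s + X i) <=
    q * survival l' (s + X i) + (g / mu * (s + M) + g / mu * X i + (H < X i)%R%:R).
  have Xi := X_ge i.
  have gp : 0 <= g / mu * (s + M) + g / mu * X i.
    by rewrite -mulrDr mulr_ge0 ?divr_ge0 ?(ltW mu0)//; lra.
  have qp : 0 <= q * survival l' (s + X i) by rewrite mulr_ge0.
  have bp : 0 <= (H < X i)%R%:R :> R by [].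
  have [sX|sX] := ltP (s + X i) 0.
    by rewrite survival_neg//; lra.
  have [sX2|sX2] := leP (2 * H) (s + X i).
    have -> : (H < X i)%R%:R = 1 :> R by have -> : H < X i by lra.
    by have := surv_le1 (j + m) (s + X i); lra.
  have [sX1|sX1] := leP H (s + X i).
    rewrite (@survival1 l'); last by lra.
    rewrite mulr1 in qp *.
    have := hq _ sX2; have := @survival_le m (j + m) (s + X i) (leq_addl _ _); lra.
  have := IHj l' (s + X i) l'j l'M; rewrite sX sX1 => /(_ isT).
  have -> : g * (s + X i + M) / mu = g / mu * (s + M) + g / mu * X i by ring.
  lra.
apply: le_trans (mean_le pt) _.
rewrite !meanD !mean_cst !meanZ -/(mean _) lerD2l.
have -> : g * (s + M) / mu = g / mu * (s + M) + g / mu * (- mu) + g.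
  by field; lra.
by rewrite lerD// lerD2l ler_wpM2l// divr_ge0// ltW.
Qed.

(** The weak law of large numbers, as a potential function for the backward
    equation.  A step is split into its truncation [Z] at [K] and the excess,
    whose accumulated values are [z] and [y].  If [z + y] is nonnegative at the
    end then the excess contributes at least [a], to which the first term
    applies by Markov's inequality, or [z] exceeds [- a], to which the second
    applies by Chebyshev's.  The two are carried separately so that a first
    moment of one and a second moment of the other can be propagated one step
    at a time. *)
Lemma survival_lln (K eta V a c : R) (m : nat) (z y : R) :
  let Z i := Num.min (X i) K in let nu := - mean Z in
  0 < a -> 2 * a <= c -> 0 <= y ->
  mean (fun i => X i - Z i) <= eta ->
  mean (fun i => Z i ^+ 2) <= V ->
  survival m (z + y) <= (y + m%:R * eta) / a +
     ((z - m%:R * nu + c) ^+ 2 + m%:R * V) / a ^+ 2.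
Proof.
move=> Z nu a0 ac y0 Eeta EV.
have YZ i : 0 <= X i - Z i by rewrite subr_ge0 ge_min lexx.
have eta0 : 0 <= eta.
  by apply: le_trans Eeta; apply: sumr_ge0 => i _; rewrite mulr_ge0.
have V0 : 0 <= V.
  by apply: le_trans EV; apply: sumr_ge0 => i _; rewrite mulr_ge0 ?sqr_ge0.
have rhs_ge0 k (t u : R) : 0 <= u -> 0 <= (u + k%:R * eta) / a +
     ((t - k%:R * nu + c) ^+ 2 + k%:R * V) / a ^+ 2.
  move=> u0; apply: addr_ge0; apply: divr_ge0.
  - by rewrite addr_ge0// mulr_ge0.
  - exact: ltW.
  - by rewrite addr_ge0 ?sqr_ge0// mulr_ge0.
  - exact: sqr_ge0.
elim: m z y y0 => [|m IHm] z y y0.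
  have [s0|s0] := ltP (z + y) 0; first by rewrite survival_neg// rhs_ge0.
  rewrite /= s0 !mul0r !addr0 subr0 -expr_div_n.
  have [ya|ya] := leP a y.
    have : 1 <= y / a by rewrite ler_pdivlMr// mul1r.
    by have := sqr_ge0 ((z + c) / a); lra.
  have zc : 1 <= (z + c) / a by rewrite ler_pdivlMr//; lra.
  have : 1 <= ((z + c) / a) ^+ 2 by rewrite expr2; nra.
  have : 0 <= y / a by rewrite divr_ge0// ltW.
  lra.
have [s0|s0] := ltP (z + y) 0; first by rewrite survival_neg// rhs_ge0.
rewrite survivalS//.
pose d := z - m.+1%:R * nu + c.
have pt i : survival m (z + y + X i) <=
   (y + m%:R * eta) / a + a^-1 * (X i - Z i) +
   (a ^- 2 * (Z i ^+ 2) + (a ^- 2 * (2 * (d + nu))) * Z i + a ^- 2 * ((d + nu) ^+ 2 + m%:R * V)).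
  have -> : z + y + X i = (z + Z i) + (y + (X i - Z i)) by ring.
  apply: le_trans (IHm _ _ _) _; first by rewrite addr_ge0.
  rewrite le_eqVlt; apply/orP; left; apply/eqP.
  have -> : z + Z i - m%:R * nu + c = Z i + (d + nu) by rewrite /d -natr1; ring.
  rewrite -exprVn; field; lra.
apply: le_trans (mean_le pt) _.
rewrite !meanD !meanZ !mean_cst.
have -> : mean Z = - nu by rewrite /nu opprK.
have hE : a^-1 * mean (fun i => X i - Z i) <= a^-1 * eta.
  by rewrite ler_wpM2l// invr_ge0 ltW.
have hV : a ^- 2 * mean (fun i => Z i ^+ 2) <= a ^- 2 * V.
  by rewrite ler_wpM2l// invr_ge0 exprn_ge0// ltW.
have hn : 0 <= a ^- 2 * nu ^+ 2 by rewrite mulr_ge0 ?sqr_ge0// invr_ge0 exprn_ge0// ltW.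
rewrite -/(d) -(natr1 m).
have -> : (y + (m%:R + 1) * eta) / a + (d ^+ 2 + (m%:R + 1) * V) / a ^+ 2 =
  (y + m%:R * eta) / a + a^-1 * eta + (a ^- 2 * V + a ^- 2 * (2 * (d + nu)) * (- nu) + a ^- 2 * ((d + nu) ^+ 2 + m%:R * V) + a ^- 2 * nu ^+ 2).
  by field; lra.
lra.
Qed.

End finite_walk.

(** * Survival probability of a walk with negative drift *)

Definition dominatedly_varying (R : realType) (F : R -> R) : Prop :=
  forall k : R, 0 < k -> exists K x0 : R, 0 < K /\
    forall x, x0 <= x -> F (k * x) <= K * F x.

(** Everything about a walk that enters the constants of the survival bound.
    The rounding grid grows with the number of steps considered, so the bound
    has to hold with the same constants for all walks of such a class.  The
    field [uw_excess] is uniform integrability of the steps. *)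
Record uniform_walk (R : realType) (F kappa : R -> R) (M mu H0 : R) (I : finType)
    (w X : I -> R) : Prop := {
  uw_ge0 : forall i, 0 <= w i;
  uw_sum1 : \sum_i w i = 1;
  uw_lower : forall i, - M <= X i;
  uw_drift : mean w X <= - mu;
  uw_tail : forall H : R, H0 <= H -> \sum_i w i * (H < X i)%R%:R <= F (H / 2);
  uw_excess : forall e : R, 0 < e ->
    mean w (fun i => X i - Num.min (X i) (kappa e)) <= e }.

(** The drift over [m] steps is [- m * mu], so surviving [m] steps from a height
    of at most half of it is a large deviation, of small probability as soon as
    [m] is large, uniformly over the class. *)
Lemma survival_small (R : realType) (F kappa : R -> R) (M mu H0 : R)
    (M_ge0 : 0 <= M) (mu_gt0 : 0 < mu) (kappa_ge0 : forall e, 0 <= kappa e)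
    (q : R) (q_gt0 : 0 < q) :
  exists m0 : nat, forall (I : finType) (w X : I -> R),
    uniform_walk F kappa M mu H0 w X -> forall m : nat, (m0 <= m)%N ->
    forall t, t <= m%:R * mu / 2 -> survival w X m t <= q.
Proof.
(* With [a = m * mu / 4] below, the excess and the variance terms of
   [survival_lln] are [4 * eta / mu] and [16 * V / (m * mu ^+ 2)]; each is made
   at most [q / 2]. *)
pose eta := mu * q / 8.
pose V := (kappa eta + M) ^+ 2.
exists (Num.truncn (32 * V / (mu ^+ 2 * q))).+1 => I w X [w0 w1 XM EX _ XK] m m0 t tm.
have V0 : 0 <= V by exact: sqr_ge0.
have mp : (0 < m)%N by exact: leq_ltn_trans m0.
have mR : 0 < m%:R :> R by rewrite ltr0n.
have mu2q : 0 < mu ^+ 2 * q by rewrite mulr_gt0// exprn_gt0.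
have mV : 32 * V <= m%:R * (mu ^+ 2 * q).
  rewrite -ler_pdivrMr//; apply: ltW; apply: lt_le_trans (truncnS_gt _) _.
  by rewrite ler_nat.
have eta0 : 0 < eta by rewrite divr_gt0// mulr_gt0.
have Em (f g : I -> R) : (forall i, f i <= g i) -> mean w f <= mean w g.
  by move=> fg; apply: ler_sum => i _; rewrite ler_wpM2l.
pose Z i := Num.min (X i) (kappa eta).
have EZ : mean w Z <= - mu by apply: le_trans (Em _ _ _) EX => i; rewrite ge_min lexx.
have mEZ : m%:R * mean w Z <= m%:R * (- mu) by rewrite ler_wpM2l// ltW.
have kE := kappa_ge0 eta.
have EV : mean w (fun i => Z i ^+ 2) <= V.
  rewrite -[leRHS]mul1r -w1 mulr_suml; apply: ler_sum => i _.
  rewrite ler_wpM2l// /V.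
  have Zl : - M <= Z i by rewrite le_min XM/=; lra.
  have Zu : Z i <= kappa eta by rewrite ge_min lexx orbT.
  nra.
pose a := m%:R * mu / 4.
have a0 : 0 < a by rewrite divr_gt0// mulr_gt0.
have := @survival_lln _ _ w X w0 w1 (kappa eta) eta V a (- (m%:R * mean w Z) - t) m t 0 a0
  _ (lexx _) (XK _ eta0) EV.
rewrite -/Z addr0 add0r => /(_ _)/le_trans; apply; first by rewrite /a; lra.
have -> : t - m%:R * - mean w Z + (- (m%:R * mean w Z) - t) = 0 by ring.
rewrite expr0n/= add0r.
have -> : m%:R * eta / a = q / 2.
  by rewrite /eta /a; field; rewrite (gt_eqF mR) (gt_eqF mu_gt0).
have : m%:R * V / a ^+ 2 <= q / 2.
  rewrite ler_pdivrMr ?exprn_gt0// /a.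
  have -> : q / 2 * (m%:R * mu / 4) ^+ 2 = m%:R * (m%:R * (mu ^+ 2 * q)) / 32 by field.
  by rewrite -mulrA ler_wpM2l ?(ltW mR)//; lra.
lra.
Qed.

(** Strong induction on [n] from [survival_step], with [H = delta * n] and [m]
    half of [n].  The weight [q] is chosen as half the inverse of a bound on
    [F (n / r) / F n], so that the recursive term contributes at most half of
    the claimed bound. *)
Lemma survival_dominated (R : realType) (F kappa : R -> R) (M mu H0 : R) :
  0 <= M -> 0 < mu -> (forall e, 0 <= kappa e) ->
  (forall x, 0 < F x) -> {homo F : x y / x <= y >-> y <= x} ->
  dominatedly_varying F ->
  exists2 C : R, 0 < C & forall (I : finType) (w X : I -> R),
    uniform_walk F kappa M mu H0 w X ->
    forall n : nat, survival w X n 0 <= C * F n%:R.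
Proof.
move=> M0 mu0 kappa0 F0 Fmono Fdom.
pose delta := mu / 12; have delta0 : 0 < delta by rewrite divr_gt0.
have ub (x : R) : exists k : nat, x <= k%:R.
  by exists (Num.truncn x).+1; rewrite ltW// truncnS_gt.
(* [r] is such that a walk at height [delta * n] cannot become negative
   within [n / r] steps. *)
have [r r_ge2 rM] : exists2 r : nat, (2 <= r)%N & M <= delta * r%:R.
  have [k hk] := ub (M / delta); exists k.+2 => //.
  rewrite mulrC -ler_pdivrMr//; apply: le_trans hk _.
  by rewrite ler_nat leqW// leqW.
have r0 : 0 < r%:R :> R by rewrite ltr0n; exact: ltnW.
have r2 : 0 < (2 * r%:R)^-1 :> R by rewrite invr_gt0 mulr_gt0.
have delta2 : 0 < delta / 2 by rewrite divr_gt0.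
have [K1 [x1 [K10 hK1]]] := Fdom _ delta2.
have [K2 [x2 [K20 hK2]]] := Fdom _ r2.
pose q := (2 * K2)^-1; have q0 : 0 < q by rewrite invr_gt0 mulr_gt0.
have [m0 hm0] := @survival_small R F kappa M mu H0 M0 mu0 kappa0 q q0.
have [[k1 hk1] [k2 hk2] [k3 hk3]] := And3 (ub x1) (ub x2) (ub (H0 / delta)).
pose n0 := (2 * m0 + 2 + r + k1 + k2 + k3)%N.
pose C := 2 * K1 * M / mu + (F n0%:R)^-1.
have C10 : 0 <= 2 * K1 * M / mu by rewrite divr_ge0 ?(ltW mu0)// !mulr_ge0// ltW.
have C0 : 0 < C by rewrite /C ltr_wpDl// invr_gt0.
exists C => // I w X wX.
have [w0 w1 XM EX Xtail XK] := wX.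
elim/ltn_ind => n IHn.
have [nn0|nn0] := ltnP n n0.
  have [_ /le_trans] := andP (survival_itv X w0 w1 n 0); apply.
  apply: le_trans (_ : (F n0%:R)^-1 * F n%:R <= _).
    by rewrite mulrC ler_pdivlMr// mul1r Fmono// ler_nat ltnW.
  by rewrite ler_wpM2r ?(ltW (F0 _))// /C; lra.
rewrite /n0 in nn0.
have big (x : R) k : x <= k%:R -> (k <= n)%N -> x <= n%:R.
  by move=> xk kn; apply: le_trans xk _; rewrite ler_nat.
have nx1 : x1 <= n%:R by apply: big hk1 _; clear -nn0; lia.
have nx2 : x2 <= n%:R by apply: big hk2 _; clear -nn0; lia.
have nH : H0 / delta <= n%:R by apply: big hk3 _; clear -nn0; lia.
pose m := (n %/ 2)%N.
have [m1 m0m n3] : [/\ (0 < m)%N, (m0 <= m)%N & (n <= 3 * m)%N] by rewrite /m; clear -nn0; split; lia.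
pose l := (n %/ r)%N.
have rn : (r <= n)%N by clear -nn0; lia.
have lj : (l <= n - m)%N.
  have : (l <= n %/ 2)%N by apply: leq_div2l.
  by rewrite /m; clear -nn0; lia.
have lr : (l * r <= n)%N by exact: leq_trunc_div.
have lr2 : (n <= 2 * r * l)%N.
  have := divn_eq n r; have := ltn_pmod n (ltnW r_ge2).
  have l1 : (0 < l)%N by rewrite /l divn_gt0 ?(ltnW r_ge2).
  rewrite -/l; clear -nn0 l1; nia.
pose H := delta * n%:R.
have nR : 0 <= n%:R :> R by [].
have nm : n%:R <= 3 * m%:R :> R by rewrite -natrM ler_nat.
have H_gt0 : 0 < H by rewrite mulr_gt0// ltr0n; clear -nn0; lia.
have := @survival_step R I w X w0 w1 M M0 XM mu H q (F (H / 2)) m l (n - m) 0 mu0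
   (ltW H_gt0) (ltW q0) EX _ _ lj.
rewrite subnK ?leq_div// lexx H_gt0 => /(_ _ _ _ isT)/le_trans; apply.
- move=> t tH; apply: (hm0 _ _ _ wX) => //.
  apply: le_trans (ltW tH) _; rewrite /H /delta.
  have := ler_wpM2l (ltW mu0) nm; lra.
- by apply: Xtail; rewrite /H mulrC -ler_pdivrMr.
- rewrite /H; apply: le_trans (_ : l%:R * (delta * r%:R) <= _); first by rewrite ler_wpM2l.
  by rewrite mulrCA ler_wpM2l ?(ltW delta0)// -natrM ler_nat.
have FH : F (H / 2) <= K1 * F n%:R.
  by have -> : H / 2 = delta / 2 * n%:R; [rewrite /H; ring | exact: hK1].
have Fl : F l%:R <= K2 * F n%:R.
  apply: le_trans (hK2 _ nx2); apply: Fmono.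
  rewrite mulrC ler_pdivrMr ?mulr_gt0//.
  by rewrite -!natrM ler_nat mulnC.
have l_lt : (l < n)%N by apply: ltn_Pdiv => //; clear -nn0; lia.
have h1 : q * survival w X l 0 <= C / 2 * F n%:R.
  apply: le_trans (_ : q * (C * (K2 * F n%:R)) <= _).
    rewrite ler_wpM2l ?(ltW q0)//; apply: le_trans (IHn _ l_lt) _.
    by rewrite ler_wpM2l// ltW.
  rewrite le_eqVlt; apply/orP; left; apply/eqP; rewrite /q; field.
  by rewrite gt_eqF.
have h2 : F (H / 2) * (0 + M) / mu <= C / 2 * F n%:R.
  apply: le_trans (_ : K1 * F n%:R * M / mu <= _).
    by rewrite add0r -!(mulrA _ M) ler_wpM2r// divr_ge0// ltW.
  have -> : K1 * F n%:R * M / mu = (2 * K1 * M / mu) / 2 * F n%:R by field; rewrite gt_eqF.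
  rewrite ler_wpM2r ?(ltW (F0 _))// ler_wpM2r//.
  by rewrite /C lerDl ltW// invr_gt0.
lra.
Qed.

(** * Sample paths of the fork-join system *)

Lemma order_stat_le (R : realType) (r : nat) (b : seq R) (x : R) :
  (0 < r <= size b)%N ->
  (order_stat r b <= x) = (r <= count (fun y => (y <= x)%R) b)%N.
Proof.
move=> /andP[r0 rb]; rewrite /order_stat.
set s := sort <=%R b.
have ss : size s = size b by rewrite size_sort.
have sorted_s : sorted <=%R s by exact: sort_le_sorted.
have nth_s i j : (i <= j < size s)%N -> nth 0 s i <= nth 0 s j.
  move=> /andP[ij js]; apply: (sorted_leq_nth le_trans (@lexx _ _)) => //.
  by rewrite inE (leq_ltn_trans ij).
have -> : count (fun y => (y <= x)%R) b = count (fun y => (y <= x)%R) s.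
  by apply: permP; rewrite perm_sym; exact: permEl (perm_sort _ _).
apply/idP/idP => [rx|].
  rewrite -(cat_take_drop r s) count_cat.
  suff -> : count (fun y => (y <= x)%R) (take r s) = r by rewrite leq_addr.
  rewrite -[RHS](@size_takel r _ s) ?ss//; apply/eqP; rewrite -all_count.
  apply/(all_nthP 0) => i; rewrite size_takel ?ss// => ir; rewrite nth_take//.
  by apply: le_trans rx; apply: nth_s; rewrite ss; case: r r0 ir rb => //= r' _; rewrite ltnS => -> ->.
rewrite leNgt => rc; apply: contraTN rc => rx; rewrite -ltnNge.
rewrite -(cat_take_drop r.-1 s) count_cat.
have /eqP -> : count (fun y => (y <= x)%R) (drop r.-1 s) == 0%N.
  rewrite -leqn0 leqNgt -has_count -all_predC.
  apply/(all_nthP 0) => i; rewrite size_drop => ir /=; rewrite nth_drop -ltNge.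
  apply: lt_le_trans rx _; apply: nth_s; rewrite leq_addr/=.
  by rewrite -ltn_subRL.
rewrite addn0; apply: leq_ltn_trans (count_size _ _) _.
rewrite size_take_min; apply: leq_ltn_trans (geq_minl _ _) _.
by rewrite prednK.
Qed.

Lemma order_stat_tuple_le (R : realType) (n r : nat) (b : n.-tuple R) (x : R) :
  (0 < r <= n)%N ->
  (order_stat r b <= x) = (r <= #|[pred i | (tnth b i <= x)%R]|)%N.
Proof.
move=> rn; rewrite order_stat_le ?size_tuple//; congr (_ <= _)%N.
by rewrite -sum1_count big_tuple -sum1_card.
Qed.

Lemma order_stat_ge0 (R : realType) (n r : nat) (b : n.-tuple R) :
  (0 < r <= n)%N -> (forall i, 0 <= tnth b i) -> 0 <= order_stat r b.
Proof.
move=> rn b0; rewrite leNgt; apply/negP => h.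
have := order_stat_tuple_le b (order_stat r b) rn; rewrite lexx => /esym.
apply/negP; rewrite -ltnNge; suff -> : #|[pred i | (tnth b i <= order_stat r b)%R]| = 0%N by case/andP: rn.
by apply: eq_card0 => i; rewrite !inE; apply/negbTE; rewrite -ltNge (lt_le_trans h).
Qed.

(** Holds for all sets, as the measure is defined by an outer measure.  The sets
    of times during which a replica is in service are not known to be
    measurable. *)
Lemma lebesgue_measure_outer_le (R : realType) (A B : set R) :
  A `<=` B -> (lebesgue_measure A <= lebesgue_measure B)%E.
Proof. by move=> AB; exact: le_mu_ext. Qed.

Section sample_path.
Context {R : realType} {N nF nJ : nat}.
Variables (T : nat -> R) (sv : nat -> {ffun 'I_nF -> 'I_N})
  (b : nat -> nF.-tuple R) (D : nat -> \bar R) (W : nat -> 'I_nF -> R -> R).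
Hypotheses (nJ_itv : (0 < nJ <= nF)%N) (b_ge0 : forall k i, 0 <= tnth (b k) i).
Hypotheses (servedW : attained_service T sv b D W) (doneD : completion nJ T b D W).

Let beta k := order_stat nJ (b k).

(** The attained service of a replica never exceeds the age of its job, so
    [nJ] replicas of size at most the age are needed for completion. *)
Lemma completion_ge k : ((T k + beta k)%:E <= D k)%E.
Proof.
rewrite doneD; apply: le_ereal_inf_tmp => _ [t [Tt card_t] <-].
rewrite lee_fin -lerBrDl /beta order_stat_tuple_le//.
apply: leq_trans card_t _; apply: subset_leq_card; apply/fintype.subsetP => i.
rewrite !inE => /le_trans; apply; rewrite -lee_fin -servedW.
apply: le_trans (_ : lebesgue_measure (`[T k, t] : set R) <= _)%E.
  apply: lebesgue_measure_outer_le => u /= [ut [[Tu _ _] _]].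
  by rewrite in_itv/= Tu.
rewrite lebesgue_measure_itv/= lte_fin; case: ifP => //= _.
by rewrite lee_fin subr_ge0.
Qed.

Definition live (l : nat) : set R := [set u | T l <= u /\ (u%:E < D l)%E].

Definition latest (m : nat) (t : R) : set R :=
  [set u | u < t] `&` live m `&` \bigcap_(l in [set l | (m < l)%N]) ~` live l.

Lemma measurable_live l : measurable (live l).
Proof.
have -> : live l = `[T l, +oo[ `&` [set u | (u%:E < D l)%E].
  by apply/seteqP; split => u /=; rewrite in_itv/= andbT.
apply: measurableI => //; case: (D l) => [r| |].
- suff -> : [set u : R | (u%:E < r%:E)%E] = `]-oo, r[%classic by [].
  by apply/seteqP; split => u /=; rewrite in_itv/= lte_fin.
- suff -> : [set u : R | (u%:E < +oo)%E] = setT by exact: measurableT.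
  by apply/seteqP; split => u //= _; rewrite ltry.
- suff -> : [set u : R | (u%:E < -oo)%E] = set0 by exact: measurable0.
  by apply/seteqP; split => u //=.
Qed.

Lemma measurable_latest m t : measurable (latest m t).
Proof.
apply: measurableI.
  apply: measurableI (measurable_live m).
  suff -> : [set u : R | u < t] = `]-oo, t[%classic by [].
  by apply/seteqP; split => u /=; rewrite in_itv.
by apply: bigcap_measurableType => l _; apply: measurableC; exact: measurable_live.
Qed.

(** No later job competes with job [m] at these times, so each of its unfinished
    replicas is in service.  If they had measure more than [beta m], all
    replicas of size at most [beta m], which are at least [nJ] many, would be
    finished at some time [t0] before the completion of [m]. *)
Lemma latest_le m t : (lebesgue_measure (latest m t) <= (beta m)%:E)%E.
Proof.
have beta0 : 0 <= beta m by exact: order_stat_ge0.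
rewrite leNgt; apply/negP => Lbig.
set L := latest m t in Lbig *.
have mL : measurable L by exact: measurable_latest.
have [c cD Lc] : exists2 c : R, (c%:E <= D m)%E & L `<=` `[T m, c[.
  case Dm : (D m) => [r| |].
  - exists (Num.min t r); first by rewrite lee_fin ge_min lexx orbT.
    move=> u [[/= ut [Tu]]]; rewrite Dm lte_fin => ur _.
    by rewrite in_itv/= Tu lt_min ut.
  - exists t; first by rewrite leey.
    by move=> u [[/= ut [Tu _]]] _; rewrite in_itv/= Tu.
  - exfalso; move: Lbig; suff -> : L = set0 by rewrite measure0 lte_fin ltNge beta0.
    by apply/seteqP; split => u //= -[[_ [_]]]; rewrite Dm.
have Lle : (lebesgue_measure L <= lebesgue_measure (`[T m, c[ : set R))%E.
  exact: lebesgue_measure_outer_le.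
rewrite lebesgue_measure_itv/= lte_fin in Lle.
have Tc : T m < c.
  by rewrite ltNge; apply/negP => cT; move: Lle; rewrite ltNge cT/= leNgt (le_lt_trans _ Lbig)// lee_fin.
rewrite Tc -EFinB in Lle.
have Lfin : lebesgue_measure L \is a fin_num.
  rewrite ge0_fin_numE//; exact: le_lt_trans Lle (ltry _).
pose e := fine (lebesgue_measure L) - beta m.
have eE : lebesgue_measure L = (beta m + e)%:E.
  by rewrite /e addrC subrK fineK.
have e0 : 0 < e by move: Lbig; rewrite eE lte_fin; lra.
rewrite eE lee_fin in Lle.
(* Only a set of measure [e] is lost by stopping at [t0]. *)
pose t0 := c - e.
have L0 : ((beta m)%:E <= lebesgue_measure (L `&` `]-oo, t0]))%E.
  have : (lebesgue_measure L <= lebesgue_measure (L `&` `]-oo, t0]) + lebesgue_measure (`]t0, c[ : set R))%E.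
    have mI : measurable (L `&` `]-oo, t0]) by exact: measurableI.
    have mJ : measurable (`]t0, c[%classic : set R) by exact: measurable_itv.
    apply: le_trans (measureU2 lebesgue_measure mI mJ).
    apply: lebesgue_measure_outer_le => u Lu /=.
    have := Lc _ Lu; rewrite /= !in_itv/= => /andP[_ ->]; rewrite andbT.
    by have [ut|ut] := leP u t0; [left | right].
  rewrite lebesgue_measure_itv/= lte_fin /t0 ltrBlDr ltrDl e0 -EFinB eE.
  have -> : c - (c - e) = e by ring.
  by rewrite EFinD leeD2rE.
have Tt0 : T m <= t0 by rewrite /t0; lra.
have t0D : (t0%:E < D m)%E by apply: lt_le_trans cD; rewrite lte_fin /t0; lra.
have served i : tnth (b m) i <= beta m -> tnth (b m) i <= W m i t0.
  move=> bi; rewrite leNgt; apply/negP => Wi.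
  have : ((beta m)%:E <= (W m i t0)%:E)%E.
    apply: le_trans L0 _; rewrite -servedW; apply: lebesgue_measure_outer_le.
    move=> u [[[_ [Tu uD]] older]] /=; rewrite in_itv/= => ut0; split => //.
    split; last first.
      by move=> l j ml _ [Tl lD _]; exact: (older l ml).
    split => //; apply: le_lt_trans Wi; rewrite -lee_fin -!servedW.
    by apply: lebesgue_measure_outer_le => v /= [vu ?]; split=> //; apply: le_trans ut0.
  by rewrite lee_fin; lra.
have : (D m <= t0%:E)%E.
  rewrite doneD; apply: ereal_inf_lbound; exists t0 => //; split => //.
  have := order_stat_tuple_le (b m) (beta m) nJ_itv; rewrite lexx => /esym h.
  apply: leq_trans h _; apply: subset_leq_card; apply/fintype.subsetP => i.
  by rewrite !inE; exact: served.
by rewrite leNgt t0D.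
Qed.

Hypothesis T_homo : {homo T : k l / (k <= l)%N >-> k <= l}.

(** While job [k] is incomplete there is a most recent incomplete job, and before
    the arrival of job [k + i] it is one of the [i] jobs from [k] on. *)
Lemma busy_period (k i : nat) (t : R) :
  (t%:E < D k)%E -> t <= T (k + i) ->
  t - T k <= \sum_(l < i) beta (k + l).
Proof.
move=> tD tT.
have sum0 : 0 <= \sum_(l < i) beta (k + l).
  by apply: sumr_ge0 => l _; exact: order_stat_ge0.
have [tk|kt] := leP t (T k); first by rewrite (le_trans _ sum0)// subr_le0.
rewrite -lee_fin.
have -> : (t - T k)%:E = lebesgue_measure (`[T k, t[ : set R).
  by rewrite lebesgue_measure_itv/= lte_fin kt.
rewrite -sumEFin.
apply: le_trans (_ : \sum_(l < i) lebesgue_measure (latest (k + l) t) <= _)%E; last first.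
  by apply: lee_sum => l _; exact: latest_le.
apply: le_trans (@Boole_inequality _ _ _ lebesgue_measure (fun l => latest (k + l) t) i
  (fun l _ => measurable_latest (k + l) t)).
apply: lebesgue_measure_outer_le => u; rewrite /= in_itv/= => /andP[ku ut].
have livek : live k u by split => //; apply: lt_trans tD; rewrite lte_fin.
have bnd l : `[< live (k + l) u >] -> (l < i)%N.
  move=> /asboolP[Tl _]; rewrite ltnNge; apply/negP => il.
  have : T (k + i) <= T (k + l) by apply: T_homo; rewrite leq_add2l.
  lra.
have exl : exists l, `[< live (k + l) u >] by exists 0%N; apply/asboolP; rewrite addn0.
case: (ex_maxnP exl (fun l hl => ltnW (bnd l hl))) => l liveL maxl.
suff : (\bigcup_(l' < i) latest (k + l') t) u by rewrite bigcup_mkord.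
exists l; first exact: (bnd _ liveL).
split; first by split => //; exact/asboolP.
move=> l' /= kl' live'; have kle : (k <= l')%N by lia.
have := maxl (l' - k)%N; rewrite subnKC// => /(_ (asboolT live')).
lia.
Qed.

End sample_path.

(** * From events to survival probabilities *)

(** Boolean counterpart of [survival], for one realisation [c] of the steps. *)
Fixpoint stay (R : realType) (I : Type) (X : I -> R) (n : nat) (s : R) (c : nat -> I) : bool :=
  (0 <= s) && (if n is n'.+1 then stay X n' (s + X (c 0%N)) (c \o S) else true).

Lemma stayP (R : realType) (I : Type) (X : I -> R) (n : nat) (s : R) (c : nat -> I) :
  (forall i, (i <= n)%N -> 0 <= s + \sum_(l < i) X (c l)) -> stay X n s c.
Proof.
elim: n s c => [|n IHn] s c h /=; have := h 0%N isT; rewrite big_ord0 addr0 => -> //=.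
apply: IHn => i ilen; have := h i.+1 ilen.
by rewrite big_ord_recl addrA.
Qed.

Section cells.
Context {d : measure_display} {Omega : measurableType d} {R : realType}.
Variables (P : probability Omega R) (I : finType).

Lemma measure_bigsetU_le (J : Type) (r : seq J) (F : J -> set Omega) :
  (forall j, measurable (F j)) ->
  (P (\big[setU/set0]_(j <- r) F j) <= \sum_(j <- r) P (F j))%E.
Proof.
move=> mF; elim: r => [|j r IHr]; first by rewrite !big_nil measure0.
rewrite !big_cons; apply: le_trans (measureU2 _ _ _) _ => //.
  exact: bigsetU_measurable.
by rewrite leeD2l.
Qed.

Section iid.
Variables (w X : I -> R) (C : nat -> Omega -> I).
Hypothesis w_ge0 : forall i, 0 <= w i.
Hypothesis mC : forall l i, measurable (C l @^-1` [set i]).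

Definition cylinder (p : seq I) : set Omega :=
  [set x | [seq C l x | l <- iota 0 (size p)] = p].

Hypothesis iidC : forall p, P (cylinder p) = (\prod_(i <- p) w i)%:E.

Lemma cylinder_rcons p i :
  cylinder (rcons p i) = cylinder p `&` C (size p) @^-1` [set i].
Proof.
apply/seteqP; split => x; rewrite /cylinder/= size_rcons -addn1 iotaD map_cat cats1 add0n.
  by move=> /eqP; rewrite eqseq_rcons => /andP[/eqP -> /eqP].
by case=> -> ->.
Qed.

Lemma measurable_cylinder p : measurable (cylinder p).
Proof.
elim/last_ind: p => [|p i IHp].
  suff -> : cylinder [::] = setT by exact: measurableT.
  by apply/seteqP; split.
by rewrite cylinder_rcons; exact: measurableI.
Qed.

Lemma measurable_stay n s j :
  measurable [set x | stay X n s (fun l => C (j + l)%N x)].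
Proof.
elim: n s j => [|n IHn] s j.
  have [s0|s0] := boolP (0 <= s); last first.
    suff -> : [set x | stay X 0 s (fun l => C (j + l)%N x)] = set0 by exact: measurable0.
    by apply/seteqP; split => // x; rewrite /= (negbTE s0).
  suff -> : [set x | stay X 0 s (fun l => C (j + l)%N x)] = setT by exact: measurableT.
  by apply/seteqP; split => // x; rewrite /= s0.
have [s0|s0] := boolP (0 <= s); last first.
  suff -> : [set x | stay X n.+1 s (fun l => C (j + l)%N x)] = set0 by exact: measurable0.
  by apply/seteqP; split => // x; rewrite /= (negbTE s0).
have -> : [set x | stay X n.+1 s (fun l => C (j + l)%N x)] =
   \big[setU/set0]_(i : I) (C j @^-1` [set i] `&`
     [set x | stay X n (s + X i) (fun l => C (j.+1 + l)%N x)]).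
  rewrite -bigcup_seq; apply/seteqP; split => x /=.
    rewrite s0 addn0 /=.
    have -> : (fun l => C (j + l)%N x) \o S = (fun l => C (j.+1 + l)%N x).
      by apply/funext => l /=; rewrite addSnnS.
    by move=> h; exists (C j x) => //=; rewrite mem_index_enum.
  move=> [i _ [/= Ci]]; rewrite s0 addn0 /= Ci.
  have -> : (fun l => C (j + l)%N x) \o S = (fun l => C (j.+1 + l)%N x).
    by apply/funext => l /=; rewrite addSnnS.
  by [].
by apply: bigsetU_measurable => i _; apply: measurableI.
Qed.

(** Prefixing a cylinder makes the induction hypothesis apply after the first
    step, where the walk restarts: independence of the future from the past is
    expressed by the product weight of the longer cylinder. *)
Lemma stay_le_survival n s p :
  (P (cylinder p `&` [set x | stay X n s (fun l => C (size p + l)%N x)]) <=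
   ((\prod_(i <- p) w i) * survival w X n s)%:E)%E.
Proof.
have wp q : 0 <= \prod_(i <- q) w i by apply: prodr_ge0 => i _.
elim: n s p => [|n IHn] s p.
  have [s0|s0] := leP 0 s; last first.
    rewrite survival_neg// mulr0.
    suff -> : [set x | stay X 0 s (fun l => C (size p + l)%N x)] = set0 by rewrite setI0 measure0.
    by apply/seteqP; split => // x; rewrite /= leNgt s0.
  rewrite [survival _ _ _ _]/= s0 mulr1 -iidC; apply: le_measure; rewrite ?inE.
  - by apply: measurableI; [exact: measurable_cylinder | exact: measurable_stay].
  - exact: measurable_cylinder.
  - exact: subIsetl.
have [s0|s0] := leP 0 s; last first.
  rewrite survival_neg// mulr0.
  suff -> : [set x | stay X n.+1 s (fun l => C (size p + l)%N x)] = set0 by rewrite setI0 measure0.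
  by apply/seteqP; split => // x; rewrite /= leNgt s0.
pose F i := cylinder (rcons p i) `&`
  [set x | stay X n (s + X i) (fun l => C (size (rcons p i) + l)%N x)].
have mF i : measurable (F i).
  by apply: measurableI; [exact: measurable_cylinder | exact: measurable_stay].
apply: (@le_trans _ _ (P (\big[setU/set0]_(i : I) F i))).
  apply: le_measure; rewrite ?inE.
  - by apply: measurableI; [exact: measurable_cylinder | exact: measurable_stay].
  - exact: bigsetU_measurable.
  - rewrite -bigcup_seq => x [/= px]; rewrite s0 addn0 /= => h.
    exists (C (size p) x); first by rewrite /= mem_index_enum.
    split; first by rewrite cylinder_rcons.
    rewrite /= size_rcons.
    suff <- : (fun l => C (size p + l)%N x) \o S = (fun l => C ((size p).+1 + l)%N x) by [].
    by apply/funext => l /=; rewrite addSnnS.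
apply: le_trans (measure_bigsetU_le _ mF) _.
rewrite survivalS// mulr_sumr -sumEFin; apply: lee_sum => i _.
apply: le_trans (IHn _ _) _.
by rewrite lee_fin -cats1 big_cat big_seq1 /= mulrA.
Qed.

End iid.

Lemma expectation_fin (Y : Omega -> I) (f : I -> R) :
  (forall i, measurable (Y @^-1` [set i])) -> (forall i, 0 <= f i) ->
  (\int[P]_x (f (Y x))%:E = (\sum_i fine (P (Y @^-1` [set i])) * f i)%:E)%E.
Proof.
move=> mY f0.
have mi i : measurable_fun setT (fun x => (\1_(Y @^-1` [set i]) x : R)%:E).
  by apply/measurable_EFinP; exact: measurable_indic.
under eq_integral => x _.
  have -> : (f (Y x))%:E = (\sum_i (f i)%:E * (\1_(Y @^-1` [set i]) x : R)%:E)%E.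
    rewrite (bigD1 (Y x))//= big1 ?adde0 => [|i iY].
      by rewrite indicE mem_set// mule1.
    by rewrite indicE memNset ?mule0//= => /esym/eqP; apply/negP.
  over.
rewrite ge0_integral_sum//; last first.
- by move=> i x _; rewrite mule_ge0// ?lee_fin.
- by move=> i; apply: measurable_funeM.
rewrite -sumEFin; apply: eq_bigr => i _.
rewrite ge0_integralZl//; last by rewrite lee_fin.
- rewrite integral_indic// setIT mulrC EFinM fineK ?fin_num_measure//.
Qed.

Lemma measurable_fin (Y : Omega -> I) (f : I -> R) :
  (forall i, measurable (Y @^-1` [set i])) ->
  measurable_fun setT (fun x => f (Y x)).
Proof.
move=> mY _ V mV; rewrite setTI.
have -> : (fun x => f (Y x)) @^-1` V = \big[setU/set0]_(i : I | `[< V (f i) >]) (Y @^-1` [set i]).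
  rewrite -bigcup_seq_cond; apply/seteqP; split => x /=.
    by move=> Vx; exists (Y x) => //=; rewrite mem_index_enum; apply/asboolP.
  by move=> [i /= /andP[_ /asboolP Vi] ->].
exact: bigsetU_measurable.
Qed.

End cells.

(** * Rounding to a grid *)

Definition grid (R : realType) (h : R) (L : nat) (x : R) : 'I_L.+1 :=
  inord (minn (Num.truncn (x / h)) L).

Section grid.
Context {R : realType}.
Variables (h : R) (L : nat).
Hypothesis h_gt0 : 0 < h.

Lemma gridE x : grid h L x = minn (Num.truncn (x / h)) L :> nat.
Proof. by rewrite inordK// ltnS geq_minr. Qed.

Lemma grid_le (x : R) : 0 <= x -> (grid h L x)%:R * h <= Num.min x (L%:R * h).
Proof.
move=> x0; rewrite gridE le_min !ler_wpM2r ?(ltW h_gt0) ?ler_nat ?geq_minr// andbT.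
rewrite -ler_pdivlMr//; apply: le_trans (_ : (Num.truncn (x / h))%:R <= _).
  by rewrite ler_nat geq_minl.
by rewrite truncn_le divr_ge0// ltW.
Qed.

Lemma grid_gt (x : R) : Num.min x (L.+1%:R * h) <= (grid h L x).+1%:R * h.
Proof.
rewrite gridE ge_min; case: leqP => _; last by rewrite lexx orbT.
by rewrite -ler_pdivrMr// ltW ?truncnS_gt.
Qed.

Lemma measurable_grid d (T : measurableType d) (Y : T -> R) i :
  measurable_fun setT Y -> measurable ((grid h L \o Y) @^-1` [set i]).
Proof.
move=> mY.
have mge m : measurable [set x | (m <= grid h L (Y x))%N].
  case: m => [|m].
    suff -> : [set x | (0 <= grid h L (Y x))%N] = setT by exact: measurableT.
    by apply/seteqP; split.
  have [mL|Lm] := ltnP m L; last first.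
    suff -> : [set x | (m < grid h L (Y x))%N] = set0 by exact: measurable0.
    apply/seteqP; split => // x /=; rewrite gridE leq_min => /andP[_].
    by rewrite ltnNge Lm.
  suff -> : [set x | (m < grid h L (Y x))%N] = Y @^-1` `[m.+1%:R * h, +oo[.
    by rewrite -[X in measurable X]setTI; apply: mY.
  apply/seteqP; split => x /=; rewrite gridE leq_min mL andbT in_itv/= andbT
    truncn_gt_nat ler_pdivlMr//.
suff -> : (grid h L \o Y) @^-1` [set i] =
    [set x | (i <= grid h L (Y x))%N] `\` [set x | (i.+1 <= grid h L (Y x))%N].
  exact: measurableD.
apply/seteqP; split => x /=; first by move=> ->; rewrite ltnn leqnn.
by move=> [ge1 /negP]; rewrite -leqNgt => ge2; apply/val_inj/anti_leq; rewrite ge1 ge2.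
Qed.

End grid.

Section means.
Context {d : measure_display} {Omega : measurableType d} {R : realType}.
Variable P : probability Omega R.

(** Uniform integrability of a single integrable variable, from monotone
    convergence of its truncations. *)
Lemma excess_small (Y : Omega -> R) :
  measurable_fun setT Y -> (forall x, 0 <= Y x) ->
  (\int[P]_x (Y x)%:E < +oo)%E -> forall e : R, 0 < e ->
  exists2 K : R, 0 <= K & (\int[P]_x (Y x - Num.min (Y x) K)%:E <= e%:E)%E.
Proof.
move=> mY Y0 Yfin e e0; apply: contrapT => no.
pose g (n : nat) x := (Num.min (Y x) n%:R)%:E.
have mg (n : nat) : measurable_fun setT (g n).
  by apply/measurable_EFinP; exact: measurable_minr.
have g0 n x : setT x -> (0 <= g n x)%E by move=> _; rewrite lee_fin le_min Y0/=.
have gmono x : setT x -> {homo g^~ x : n m / (n <= m)%N >-> (n <= m)%E}.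
  move=> _ n m nm; rewrite lee_fin le_min ge_min lexx/= ge_min.
  by rewrite ler_nat nm orbT.
have := @cvg_monotone_convergence _ _ _ P _ measurableT _ mg g0 gmono.
have -> : (fun x => limn (g^~ x)) = (fun x => (Y x)%:E).
  apply/funext => x; apply/cvg_lim => //; apply: cvg_near_cst.
  near=> n; rewrite /g; congr EFin; apply/min_idPl.
  by apply: ltW; apply: lt_le_trans (truncnS_gt _) _; rewrite ler_nat; near: n; exact: nbhs_infty_ge.
move=> gY.
have Yint : (\int[P]_x (Y x)%:E)%E \is a fin_num.
  by rewrite ge0_fin_numE// integral_ge0// => x _; rewrite lee_fin.
have fin (f : Omega -> R) : measurable_fun setT f ->
    (forall x, 0 <= f x <= Y x) -> (\int[P]_x (f x)%:E)%E \is a fin_num.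
  move=> mf fY; rewrite ge0_fin_numE; last first.
    by apply: integral_ge0 => x _; rewrite lee_fin; case/andP: (fY x).
  apply: le_lt_trans Yfin; apply: ge0_le_integral => //.
  - by move=> x _; rewrite lee_fin; case/andP: (fY x).
  - exact/measurable_EFinP.
  - exact/measurable_EFinP.
  - by move=> x _; rewrite lee_fin; case/andP: (fY x).
have mmin n : measurable_fun setT (fun x => Num.min (Y x) n%:R) by exact: measurable_minr.
have mexc n : measurable_fun setT (fun x => Y x - Num.min (Y x) n%:R).
  exact: measurable_funB.
have exc0 n x : 0 <= Y x - Num.min (Y x) n%:R by rewrite subr_ge0 ge_min lexx.
have gle n : (\int[P]_x g n x <= \int[P]_x (Y x)%:E - e%:E)%E.
  rewrite leNgt; apply/negP => big; apply: no; exists n%:R => //.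
  have gfin : (\int[P]_x g n x)%E \is a fin_num.
    by apply: fin => // x; rewrite le_min Y0/= ge_min lexx ler0n.
  have efin : (\int[P]_x (Y x - Num.min (Y x) n%:R)%:E)%E \is a fin_num.
    by apply: fin => // x; rewrite exc0/= lerBlDr lerDl le_min Y0/=.
  have : (\int[P]_x (Y x)%:E = (\int[P]_x (Y x - Num.min (Y x) n%:R)%:E) + \int[P]_x g n x)%E.
    rewrite -ge0_integralD//.
    - by apply: eq_integral => x _; rewrite -EFinD subrK.
    - by move=> x _; rewrite lee_fin.
    - exact/measurable_EFinP.
    - by move=> x; exact: g0.
  rewrite -{1}(fineK efin) -(fineK gfin) -(fineK Yint) -EFinD => -[eqY].
  rewrite -(fineK efin) lee_fin.
  by move: big; rewrite -(fineK gfin) -(fineK Yint) -EFinB lte_fin; lra.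
have : (limn (fun n => \int[P]_x g n x) <= \int[P]_x (Y x)%:E - e%:E)%E.
  by apply: lime_le; [exact: cvgP gY | exact: nearW].
rewrite (cvg_lim _ gY)// -(fineK Yint) -EFinB lee_fin.
by rewrite lerBrDr gerDl leNgt e0.
Unshelve. all: by end_near. Qed.

End means.

(** * The rounded walk *)

Section product_mean.
Context {R : realType} {I J : finType}.
Variables (p : I -> R) (q : J -> R).

Lemma mean_fst (u : I -> R) : \sum_j q j = 1 ->
  mean (fun k : I * J => p k.1 * q k.2) (fun k => u k.1) = mean p u.
Proof.
move=> q1; rewrite /mean -(pair_bigA _ (fun i j => p i * q j * u i))/=.
by apply: eq_bigr => i _; rewrite -mulr_suml -mulr_sumr q1 mulr1.
Qed.

Lemma mean_snd (u : J -> R) : \sum_i p i = 1 ->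
  mean (fun k : I * J => p k.1 * q k.2) (fun k => u k.2) = mean q u.
Proof.
move=> p1; rewrite /mean -(pair_bigA _ (fun i j => p i * q j * u j))/= exchange_big.
by apply: eq_bigr => j _; rewrite -mulr_suml -mulr_suml p1 mul1r.
Qed.

End product_mean.

Section grid_walk.
Context {d : measure_display} {Omega : measurableType d} {R : realType}.
Variables (P : probability Omega R) (h : R).
Hypothesis h_gt0 : 0 < h.

Definition grid_law (L : nat) (Y : Omega -> R) (i : 'I_L.+1) : R :=
  fine (P ((grid h L \o Y) @^-1` [set i])).
Arguments grid_law L Y i : clear implicits.

Lemma grid_law_ge0 L Y i : 0 <= grid_law L Y i.
Proof. exact: fine_ge0. Qed.

Section grid_law.
Variables (L : nat) (Y : Omega -> R).
Hypotheses (mY : measurable_fun setT Y).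

Let mgrid i : measurable ((grid h L \o Y) @^-1` [set i]).
Proof. exact: measurable_grid. Qed.

Lemma grid_law_mean (f : 'I_L.+1 -> R) : (forall i, 0 <= f i) ->
  (\int[P]_x (f (grid h L (Y x)))%:E = (mean (grid_law L Y) f)%:E)%E.
Proof. by move=> f0; exact: (expectation_fin P mgrid f0). Qed.

Lemma grid_law_sum1 : \sum_i grid_law L Y i = 1.
Proof.
have := @grid_law_mean (fun=> 1) (fun=> ler01).
rewrite integral_cst//= probability_setT mule1 => -[->].
by apply: eq_bigr => i _; rewrite mulr1.
Qed.

Lemma grid_law_mean_le (f : 'I_L.+1 -> R) (g : Omega -> R) (c : R) :
  (forall i, 0 <= f i) -> measurable_fun setT g ->
  (forall x, f (grid h L (Y x)) <= g x) -> (\int[P]_x (g x)%:E <= c%:E)%E ->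
  mean (grid_law L Y) f <= c.
Proof.
move=> f0 mg fg gc; rewrite -lee_fin -(grid_law_mean f0).
apply: le_trans gc; apply: ge0_le_integral => //.
- by move=> x _; rewrite lee_fin.
- by apply/measurable_EFinP; exact: (measurable_fin f mgrid).
- exact/measurable_EFinP.
- by move=> x _; rewrite lee_fin.
Qed.

End grid_law.

Definition grid_weight (LA LB : nat) (Z Y : Omega -> R) (k : 'I_LA.+1 * 'I_LB.+1) : R :=
  grid_law LA Z k.1 * grid_law LB Y k.2.

(** Service times are rounded up and interarrival times down, so that the rounded
    walk is above the original one; the end of the grid of interarrival times
    provides their truncation. *)
Definition grid_step (LA LB : nat) (k : 'I_LA.+1 * 'I_LB.+1) : R :=
  k.2.+1%:R * h - k.1%:R * h.

(** The constants do not depend on [LB], the size of the grid of service times: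
    rounding moves each variable by at most [h], which costs [2 * h] in the
    drift and [h] in the truncation level, while a step larger than [H >= 2 * h]
    comes from a service time larger than [H - h >= H / 2]. *)
Lemma uniform_grid_walk (LA LB : nat) (Z Y : Omega -> R) (kappa : R -> R) (z y e : R) :
  measurable_fun setT Z -> measurable_fun setT Y ->
  (forall x, 0 <= Z x) -> (forall x, 0 <= Y x) ->
  (\int[P]_x (Z x)%:E = z%:E)%E -> (\int[P]_x (Y x)%:E = y%:E)%E ->
  (\int[P]_x (Z x - Num.min (Z x) (LA%:R * h))%:E <= e%:E)%E ->
  (forall e, 0 < e -> (\int[P]_x (Y x - Num.min (Y x) (kappa e))%:E <= e%:E)%E) ->
  uniform_walk (tail P (EFin \o Y)) (fun e => kappa e + h) (LA%:R * h)
    (z - e - y - 2 * h) (2 * h)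
    (@grid_weight LA LB Z Y) (@grid_step LA LB).
Proof.
move=> mZ mY Z0 Y0 Ez Ey Ze Yk.
have pa1 := grid_law_sum1 LA mZ.
have pb1 := grid_law_sum1 LB mY.
have h0 := ltW h_gt0.
pose u (i : 'I_LB.+1) : R := i.+1%:R * h.
pose v (i : 'I_LA.+1) : R := i%:R * h.
have u0 i : 0 <= u i by rewrite mulr_ge0.
have v0 i : 0 <= v i by rewrite mulr_ge0.
have uY x : u (grid h LB (Y x)) <= Y x + h.
  rewrite /u -natr1 mulrDl mul1r lerD2r.
  by have := @grid_le _ h LB h_gt0 _ (Y0 x); rewrite le_min => /andP[].
have w0 k : 0 <= @grid_weight LA LB Z Y k by rewrite mulr_ge0 ?grid_law_ge0.
have w1 : \sum_k @grid_weight LA LB Z Y k = 1.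
  have m1 (K : finType) (p : K -> R) : mean p (fun=> 1) = \sum_k p k.
    by apply: eq_bigr => k _; rewrite mulr1.
  by rewrite -(m1 _ (@grid_weight LA LB Z Y)) (mean_fst _ (fun=> 1) pb1) m1.
have mean_le (f g : 'I_LA.+1 * 'I_LB.+1 -> R) : (forall k, f k <= g k) ->
    mean (@grid_weight LA LB Z Y) f <= mean (@grid_weight LA LB Z Y) g.
  by move=> fg; apply: ler_sum => k _; rewrite ler_wpM2l.
have intc (c : R) : (\int[P]_x c%:E = c%:E)%E.
  by rewrite integral_cst//= probability_setT mule1.
have intD (f g : Omega -> R) : measurable_fun setT f -> measurable_fun setT g ->
    (forall x, 0 <= f x) -> (forall x, 0 <= g x) ->
    (\int[P]_x (f x + g x)%:E = (\int[P]_x (f x)%:E) + (\int[P]_x (g x)%:E))%E.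
  move=> mf mg f0 g0; rewrite -ge0_integralD//.
  - by move=> x _; rewrite lee_fin.
  - exact/measurable_EFinP.
  - by move=> x _; rewrite lee_fin.
  - exact/measurable_EFinP.
have mtail c : measurable [set x | c < Y x].
  have -> : [set x | c < Y x] = Y @^-1` `]c, +oo[.
    by apply/seteqP; split => x /=; rewrite in_itv/= andbT.
  by rewrite -[X in measurable X]setTI; exact: mY.
split=> //.
- move=> k; rewrite /grid_step -/(u k.2) -/(v k.1).
  have : v k.1 <= LA%:R * h by rewrite ler_wpM2r// ler_nat -ltnS.
  by have := u0 k.2; lra.
- have -> : mean (@grid_weight LA LB Z Y) (@grid_step LA LB) =
     mean (grid_law LB Y) u - mean (grid_law LA Z) v.
    rewrite -(mean_snd (grid_law LB Y) u pa1) -(mean_fst (grid_law LA Z) v pb1).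
    rewrite /mean -sumrB; apply: eq_bigr => k _.
    by rewrite -mulrBr.
  have uy : mean (grid_law LB Y) u <= y + h.
    apply: (grid_law_mean_le mY u0 _ uY).
      by apply: measurable_funD => //; exact: measurable_cst.
    by rewrite intD// Ey intc.
  have vz : z <= mean (grid_law LA Z) v + h + e.
    rewrite -lee_fin -Ez.
    have mv : measurable_fun setT (fun x => v (grid h LA (Z x))).
      by apply: (measurable_fin v) => i; exact: measurable_grid.
    have mvh : measurable_fun setT (fun x => v (grid h LA (Z x)) + h).
      by apply: measurable_funD => //; exact: measurable_cst.
    have mexc : measurable_fun setT (fun x => Z x - Num.min (Z x) (LA%:R * h)).
      by apply: measurable_funB => //; exact: measurable_minr.
    have exc0 x : 0 <= Z x - Num.min (Z x) (LA%:R * h) by rewrite subr_ge0 ge_min lexx.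
    apply: (@le_trans _ _ (\int[P]_x (v (grid h LA (Z x)) + h +
        (Z x - Num.min (Z x) (LA%:R * h)))%:E)%E).
      apply: ge0_le_integral => //.
      - by move=> x _; rewrite lee_fin.
      - exact/measurable_EFinP.
      - by apply/measurable_EFinP; exact: measurable_funD.
      - move=> x _; rewrite lee_fin.
        have : Num.min (Z x) (LA%:R * h) <= v (grid h LA (Z x)) + h.
          apply: le_trans (_ : Num.min (Z x) (LA.+1%:R * h) <= _).
            by rewrite le_min !ge_min lexx/= ler_wpM2r ?orbT// ler_nat.
          by apply: le_trans (grid_gt LA h_gt0 _) _; rewrite /v -natr1 mulrDl mul1r.
        lra.
    rewrite intD//; last by move=> x; rewrite addr_ge0.
    rewrite intD// intc (grid_law_mean mZ v0) EFinD EFinD.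
    exact: leeD2l.
  lra.
- move=> H hH.
  apply: (@le_trans _ _ (mean (grid_law LB Y) (fun i => (H < u i)%R%:R))).
    rewrite -(mean_snd (grid_law LB Y) _ pa1); apply: mean_le => k.
    rewrite ler_nat; case: (ltP H (u k.2)) => [_|Hu]; first exact: leq_b1.
    suff -> : (H < grid_step k) = false by [].
    apply/negbTE; rewrite -leNgt /grid_step -/(u k.2) -/(v k.1).
    by have := v0 k.1; lra.
  apply: (grid_law_mean_le mY (g := \1_[set x | H / 2 < Y x])) => //.
  - move=> x; rewrite indicE; case: ltP => // Hu.
    by rewrite mem_set//=; have := uY x; lra.
  - by rewrite integral_indic// setIT /tail fineK ?fin_num_measure//; exact: mtail.
- move=> e' e'0.
  apply: (@le_trans _ _ (mean (grid_law LB Y) (fun i => u i - Num.min (u i) (kappa e' + h)))).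
    rewrite -(mean_snd (grid_law LB Y) _ pa1); apply: mean_le => k.
    rewrite /grid_step -/(u k.2) -/(v k.1).
    have := v0 k.1; rewrite !minEle; case: ifP => _; case: ifP; lra.
  apply: (grid_law_mean_le mY (g := fun x => Y x - Num.min (Y x) (kappa e'))) => //.
  - by move=> i; rewrite subr_ge0 ge_min lexx.
  - by apply: measurable_funB => //; exact: measurable_minr.
  - move=> x; have uYx := uY x; rewrite !minEle; case: (leP (u _)) => h1; case: (leP (Y x)) => h2; lra.
  - exact: Yk.
Qed.

End grid_walk.

(** * Independence of the rounded input *)

(** The order statistic is at most [x] when, for some index set of size at least
    [r], all entries in that set are. *)
Lemma measurable_order_stat (R : realType) (n r : nat) : (0 < r <= n)%N ->
  measurable_fun setT (fun b : n.-tuple R => order_stat r b).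
Proof.
move=> rn; apply: (measurability _ (RGenOInfty.measurableE R)).
move=> _ [_ [x ->] <-]; rewrite setTI.
have -> : (fun b : n.-tuple R => order_stat r b) @^-1` `]x, +oo[ =
    ~` \big[setU/set0]_(J : {set 'I_n} | (r <= #|J|)%N)
         \big[setI/setT]_(i <- enum J) ((fun b => tnth b i) @^-1` `]-oo, x]).
  apply/seteqP; split => b; rewrite /= in_itv/= andbT ltNge order_stat_tuple_le//.
    move=> /negP bx; rewrite -bigcup_seq_cond => -[J /= /andP[_ rJ]].
    rewrite -bigcap_seq => JP; apply: bx; apply: leq_trans rJ _.
    apply: subset_leq_card; apply/fintype.subsetP => i iJ.
    have := JP i; rewrite /= mem_enum in_itv/= inE; exact.
  move=> bx; apply/negP => rx; apply: bx; rewrite -bigcup_seq_cond.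
  exists [set i | (tnth b i <= x)%R]%SET.
    by rewrite /= mem_index_enum cardsE.
  rewrite -bigcap_seq => i; rewrite /= mem_enum inE => ix.
  by rewrite in_itv.
apply: measurableC; apply: bigsetU_measurable => J _.
apply: bigsetI_measurable => i _; rewrite -[X in measurable X]setTI.
exact: measurable_tnth.
Qed.

Section fork_join.
Context {d : measure_display} {Omega : measurableType d} {R : realType}.
Variables (P : probability Omega R) (N nF nJ : nat).
Variables (A : nat -> {RV P >-> R}) (s : nat -> Omega -> {ffun 'I_nF -> 'I_N})
  (B : nat -> {RV P >-> nF.-tuple R}).
Hypotheses (nJ_itv : (0 < nJ <= nF)%N) (input : fork_join_input A s B).

Let beta := order_stat_size nJ B.

Lemma measurable_order_stat_size k : measurable_fun setT (beta k).
Proof.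
exact: measurableT_comp (measurable_order_stat nJ_itv) (measurable_funPT (B k)).
Qed.

Lemma order_stat_size_ge0 k w : 0 <= beta k w.
Proof. by apply: order_stat_ge0 => // i; exact: (size_ge0 input). Qed.

Lemma order_stat_size_id k (V : set R) : measurable V ->
  P (beta k @^-1` V) = P (beta 0%N @^-1` V).
Proof.
move=> mV; have mV' : measurable ((fun b : nF.-tuple R => order_stat nJ b) @^-1` V).
  by rewrite -[X in measurable X]setTI; exact: measurable_order_stat.
exact: (size_id input k mV').
Qed.

Variables (h : R) (LA LB k : nat).
Hypothesis h_gt0 : 0 < h.

(** The [l]-th step of the walk seen by job [k]: the service time of job [k + l]
    and the time from its arrival to the next one. *)
Definition cell (l : nat) (w : Omega) : 'I_LA.+1 * 'I_LB.+1 :=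
  (grid h LA (A (k.+1 + l) w), grid h LB (beta (k + l) w)).

Lemma measurable_cell l i : measurable (cell l @^-1` [set i]).
Proof.
have -> : cell l @^-1` [set i] = (grid h LA \o A (k.+1 + l)) @^-1` [set i.1] `&`
   (grid h LB \o beta (k + l)) @^-1` [set i.2].
  apply/seteqP; split => w; rewrite /cell /=; case: i => a b; first by move=> [-> ->].
  by move=> /= [-> ->].
apply: measurableI; apply: measurable_grid => //.
exact: measurable_order_stat_size.
Qed.

(** A cylinder is an intersection of events, one for each of the interarrival
    times and size vectors involved, so mutual independence applies directly. *)
Lemma cell_iid (p : seq ('I_LA.+1 * 'I_LB.+1)) :
  P (cylinder cell p) = (\prod_(i <- p) grid_weight P h (A 0%N) (beta 0%N) i)%:E.
Proof.
pose i0 : 'I_LA.+1 * 'I_LB.+1 := (ord0, ord0).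
pose VA l : set R := (grid h LA \o id) @^-1` [set (nth i0 p l).1].
pose VB l : set R := (grid h LB \o id) @^-1` [set (nth i0 p l).2].
have mVA l : measurable (VA l) by exact: measurable_grid.
have mVB l : measurable (VB l) by exact: measurable_grid.
pose E (i : nat + nat + nat) : set Omega :=
  match i with
  | inl (inl m) => A m @^-1` VA (m - k.+1)%N
  | inl (inr _) => setT
  | inr m => beta m @^-1` VB (m - k)%N
  end.
pose n := size p.
pose JA := [seq (inl (inl (k.+1 + l)) : nat + nat + nat)%N | l <- iota 0 n].
pose JB := [seq (inr (k + l) : nat + nat + nat)%N | l <- iota 0 n].
have cylE : cylinder cell p = \big[setI/setT]_(j <- JA ++ JB) E j.
  rewrite -bigcap_seq; apply/seteqP; split => w.
    rewrite /cylinder /= => wp j; rewrite /= mem_cat => /orP[] /mapP[l];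
      rewrite mem_iota add0n => /= ln ->; rewrite /= addKn /VA /VB /= -wp;
      by rewrite (nth_map 0%N) ?size_iota// nth_iota.
  move=> h'; rewrite /cylinder /=; apply: (@eq_from_nth _ i0); rewrite size_map size_iota// => l ln.
  rewrite (nth_map 0%N) ?size_iota// nth_iota// add0n /cell.
  have /= := h' (inl (inl (k.+1 + l)%N)); rewrite mem_cat map_f ?mem_iota// => /(_ isT).
  have /= := h' (inr (k + l)%N); rewrite mem_cat (map_f (fun l => inr (k + l)%N)) ?mem_iota// orbT => /(_ isT).
  rewrite !addKn /VA /VB /= => -> ->.
  by case: (nth _ _ _).
have [_ indep] := input_indep input.
rewrite cylE indep; first last.
- move=> j; rewrite mem_cat => /orP[] /mapP[l _ ->] /=.
    by exists (VA (k.+1 + l - k.+1)%N) => //; rewrite setTI.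
  exists ((fun b : nF.-tuple R => order_stat nJ b) @^-1` VB (k + l - k)%N); last by rewrite setTI.
  by rewrite -[X in measurable X]setTI; exact: measurable_order_stat.
- rewrite cat_uniq !map_inj_uniq ?iota_uniq//=; last 2 first.
  + by move=> a b [/addnI].
  + by move=> a b [/addnI].
  by rewrite andbT; apply/hasPn => j /mapP[l _ ->]; apply/mapP => -[].
rewrite big_cat !big_map /=.
have PA l : P (A (k.+1 + l)%N @^-1` VA (k.+1 + l - k.+1)%N) =
    (grid_law P h (A 0%N) (nth i0 p l).1)%:E.
  rewrite addKn /grid_law fineK ?fin_num_measure//; last exact: measurable_grid.
  exact: (interarrival_id input).
have PB l : P (beta (k + l)%N @^-1` VB (k + l - k)%N) =
    (grid_law P h (beta 0%N) (nth i0 p l).2)%:E.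
  rewrite addKn /grid_law fineK ?fin_num_measure//; last first.
    by apply: measurable_grid => //; exact: measurable_order_stat_size.
  by rewrite order_stat_size_id.
under eq_bigr do rewrite PA.
under [X in (_ * X)%E]eq_bigr do rewrite PB.
rewrite !prodEFin -EFinM -big_split/= (big_nth i0) /index_iota subn0.
by [].
Qed.

End fork_join.

(** * Tails, regular variation and continuity points *)

(** A monotone function has countably many jumps, and an interval is not
    countable. *)
Lemma nonincreasing_continuity_point (R : realType) (f : R -> R) (a b : R) :
  {homo f : x y / x <= y >-> y <= x} -> a < b ->
  exists2 x, a < x < b & {for x, continuous f}.
Proof.
move=> ndf ab; apply: contrapT => no.
pose g x := - f x.
have ndg : {homo g : x y / x <= y} by move=> x y xy; rewrite lerN2; exact: ndf.
have all_disc : `]a, b[ `<=` [set x | x \in `]a, b[%R /\ discontinuity g x].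
  move=> x /= xab; split => //.
  have cl : cvg (g z @[z --> x^'-]).
    apply: nondecreasing_at_left_is_cvgr.
      by near=> z; move=> y1 y2 _ _; exact: ndg.
    by near=> z; exists (g x) => _ [y + <-]; rewrite /= in_itv/= => /andP[_ /ltW/ndg].
  have cr : cvg (g z @[z --> x^'+]).
    apply: nondecreasing_at_right_is_cvgr.
      by near=> z; move=> y1 y2 _ _; exact: ndg.
    by near=> z; exists (g x) => _ [y + <-]; rewrite /= in_itv/= => /andP[/ltW/ndg].
  split => //; apply/eqP => lr; apply: no; exists x; first by move: xab; rewrite in_itv.
  have gx : lim (g z @[z --> x^'-]) = g x.
    apply/eqP; rewrite eq_le; apply/andP; split.
      by apply: limr_le => //; near=> z; apply: ndg; near: z; exact: nbhs_left_le.
    rewrite lr.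
    by apply: limr_ge => //; near=> z; apply: ndg; near: z; exact: nbhs_right_ge.
  have cg : {for x, continuous g}.
    apply/left_right_continuousP; split; first by rewrite -[X in _ --> X]gx.
    by rewrite -[X in _ --> X]gx lr.
  have -> : f = (fun z => - g z) by apply/funext => z; rewrite opprK.
  exact: continuousN.
have : countable (`]a, b[ : set R).
  apply: sub_countable (subset_card_le all_disc) _.
  by apply: discontinuity_countable => x y _ _; exact: ndg.
move=> /countable_lebesgue_measure0 /eqP.
by rewrite lebesgue_measure_itv/= lte_fin ab -EFinB eqe subr_eq0 gt_eqF.
Unshelve. all: by end_near. Qed.

Lemma limf_einf_ge (R : realType) (f : R -> R) (c : R) :
  (\forall x \near +oo, c <= f x) ->
  (c%:E <= limf_einf (EFin \o f) (+oo%R : set_system R))%E.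
Proof.
move=> cf; rewrite limf_einfE; apply: ereal_sup_ge.
exists (ereal_inf ((EFin \o f) @` [set x | c <= f x])); first by exists [set x | c <= f x].
by apply: le_ereal_inf_tmp => _ [x /= cx <-]; rewrite lee_fin.
Qed.

Lemma limf_esup_le (R : realType) (f : R -> R) (c : R) :
  (\forall x \near +oo, f x <= c) ->
  (limf_esup (EFin \o f) (+oo%R : set_system R) <= c%:E)%E.
Proof.
move=> cf; rewrite limf_esupE; apply: ereal_inf_le.
exists (ereal_sup ((EFin \o f) @` [set x | f x <= c])); first by exists [set x | f x <= c].
by apply: ge_ereal_sup => _ [x /= cx <-]; rewrite lee_fin.
Qed.

Lemma limf_einf_le_esup (R : realType) (f : R -> R) :
  (limf_einf (EFin \o f) (+oo%R : set_system R) <=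
   limf_esup (EFin \o f) (+oo%R : set_system R))%E.
Proof.
rewrite limf_einfE limf_esupE; apply: ge_ereal_sup => _ [V FV <-].
apply: le_ereal_inf_tmp => _ [W FW <-].
have [x [Vx Wx]] := @filter_ex _ (+oo%R : set_system R) _ _ (filterI FV FW).
apply: (@le_trans _ _ (f x)%:E); first by apply: ereal_inf_lbound; exists x.
by apply: ereal_sup_ubound; exists x.
Qed.

Lemma tail_nonincreasing d (T : measurableType d) (R : realType) (P : probability T R)
    (X : T -> \bar R) : measurable_fun setT X ->
  {homo tail P X : x y / x <= y >-> y <= x}.
Proof.
move=> mX x y xy; have mt (z : R) : measurable [set w | (z%:E < X w)%E].
  by rewrite -[X in measurable X]setTI; exact: emeasurable_fun_o_infty.
apply: fine_le; rewrite ?fin_num_measure//; apply: le_measure; rewrite ?inE//.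
by move=> w /=; apply: le_lt_trans; rewrite lee_fin.
Qed.

Section regular_variation.
Context {R : realType} {d : measure_display} {T : measurableType d}.
Variables (P : probability T R) (X : T -> \bar R) (rho : R).
Hypotheses (mX : measurable_fun setT X) (rvX : regularly_varying P X rho).

Lemma tail_ratio_cvg alpha : 0 < alpha ->
  tail P X (alpha * x) / tail P X x @[x --> +oo] --> alpha `^ rho.
Proof.
move=> a0; have [L Lsv LE] := rvX.
have -> : alpha `^ rho = 1 * alpha `^ rho by rewrite mul1r.
apply: (@cvg_trans _ ((L (alpha * x) / L x) * alpha `^ rho @[x --> +oo])).
  apply: near_eq_cvg; near=> x.
  have x0 : 0 < x by near: x; exact: nbhs_pinfty_gt.
  rewrite !LE ?mulr_gt0// powRM ?ltW// invfM.
  have xr : x `^ rho != 0 by rewrite gt_eqF// powR_gt0.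
  transitivity ((L (alpha * x) / L x) * alpha `^ rho * (x `^ rho / x `^ rho)); last by ring.
  by rewrite divff// mulr1.
by apply: cvgM; [exact: Lsv | exact: cvg_cst].
Unshelve. all: by end_near. Qed.

(** Slow variation excludes the value zero at arbitrarily large arguments, and a
    tail that vanishes once vanishes from then on. *)
Lemma tail_gt0 x : 0 < tail P X x.
Proof.
have [L Lsv LE] := rvX.
rewrite lt_neqAle eq_sym; apply/andP; split; last exact: fine_ge0.
apply/negP => /eqP Fx0.
have L1 := cvgr_neq0 _ (Lsv 1 ltr01) (oner_neq0 R).
have [y [Ly xy y0]] : exists y, [/\ L (1 * y) / L y != 0, x <= y & 0 < y].
  near (+oo%R : set_system R) => y; exists y; split.
  - by near: y; exact: L1.
  - by near: y; apply: nbhs_pinfty_ge; exact: num_real.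
  - by near: y; apply: nbhs_pinfty_gt; exact: num_real.
have Fy : tail P X y = 0.
  by apply/eqP; rewrite eq_le fine_ge0// andbT -Fx0 (tail_nonincreasing P mX).
move: Ly; rewrite mul1r; have := LE _ y0; rewrite Fy => /esym/eqP.
rewrite mulf_eq0 (gt_eqF (powR_gt0 _ y0)) orbF => /eqP ->.
by rewrite mul0r eqxx.
Unshelve. all: by end_near. Qed.

Lemma tail_dominatedly_varying : dominatedly_varying (tail P X).
Proof.
move=> k k0; have := cvgr_lt _ (tail_ratio_cvg k0) (k `^ rho + 1) (ltr_pwDr ltr01 (lexx _)).
move=> [x0 [_ hx0]]; exists (k `^ rho + 1), (x0 + 1); split.
  by rewrite ltr_wpDl// powR_ge0.
move=> x xx0; rewrite -ler_pdivrMr ?tail_gt0// ltW// hx0//.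
by apply: lt_le_trans xx0; rewrite ltrDl.
Qed.

End regular_variation.

(** If the tail of [Y] is within constant factors of that of [X], the ratios
    defining O-regular variation of [Y] are within constant factors of the
    convergent ratios of [X]. *)
Lemma O_regularly_varying_sandwich (R : realType) d (T : measurableType d)
    (P : probability T R) (X : T -> \bar R) d' (T' : measurableType d')
    (Q : probability T' R) (Y : T' -> \bar R) (rho a b x0 : R) :
  measurable_fun setT X -> regularly_varying P X rho ->
  0 < a -> 0 < b ->
  (forall x, x0 <= x -> a * tail P X x <= tail Q Y x <= b * tail P X x) ->
  O_regularly_varying Q Y rho.
Proof.
move=> mX rvX a0 b0 sand.
have F0 := tail_gt0 mX rvX.
exists (a / b / 4), (4 * (b / a)).
have ab0 : 0 < a / b by rewrite divr_gt0.
have ba0 : 0 < b / a by rewrite divr_gt0.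
split; [by rewrite divr_gt0 | by rewrite mulr_gt0 | move=> al al1 ratio].
have al0 : 0 < al by rewrite (lt_le_trans ltr01).
have ar0 : 0 < al `^ rho by exact: powR_gt0.
have cv := tail_ratio_cvg rvX al0.
have ev : \forall x \near +oo, [/\ x0 <= x, 0 < x,
    al `^ rho / 2 < tail P X (al * x) / tail P X x &
    tail P X (al * x) / tail P X x < 2 * al `^ rho].
  near=> x; split; near: x.
  - by apply: nbhs_pinfty_ge; exact: num_real.
  - by apply: nbhs_pinfty_gt; exact: num_real.
  - by apply: cvgr_gt cv _ _; lra.
  - by apply: cvgr_lt cv _ _; lra.
have bounds x : x0 <= x -> 0 < x ->
    a / b * (tail P X (al * x) / tail P X x) <= tail Q Y (al * x) / tail Q Y x
      <= b / a * (tail P X (al * x) / tail P X x).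
  move=> xx0 xp; have /andP[l1 u1] := sand _ xx0.
  have alx : x0 <= al * x by apply: le_trans xx0 _; rewrite ler_peMl// ltW.
  have /andP[l2 u2] := sand _ alx.
  have G0 : 0 < tail Q Y x by apply: lt_le_trans l1; rewrite mulr_gt0.
  have Fx := F0 x; have Fax := F0 (al * x).
  apply/andP; split.
    rewrite ler_pdivlMr//.
    apply: le_trans (_ : a / b * (tail P X (al * x) / tail P X x) * (b * tail P X x) <= _).
      by rewrite ler_wpM2l// mulr_ge0// ltW// divr_gt0.
    rewrite (_ : _ * (b * _) = a * tail P X (al * x))//.
    by field; rewrite !gt_eqF.
  rewrite ler_pdivrMr//.
  apply: le_trans (_ : _ <= b / a * (tail P X (al * x) / tail P X x) * (a * tail P X x)) _; last first.
    by rewrite ler_wpM2l// mulr_ge0// ltW// divr_gt0.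
  rewrite (_ : _ * (a * _) = b * tail P X (al * x))//.
  by field; rewrite !gt_eqF.
split; last 2 first.
- exact: limf_einf_le_esup.
- apply: le_lt_trans (_ : (2 * (b / a) * al `^ rho)%:E < _)%E.
    apply: limf_esup_le; near=> x.
    have [xx0 xp _ up] : [/\ x0 <= x, 0 < x,
      al `^ rho / 2 < tail P X (al * x) / tail P X x &
      tail P X (al * x) / tail P X x < 2 * al `^ rho] by near: x.
    have /andP[_ /le_trans] := bounds _ xx0 xp; apply.
    have -> : 2 * (b / a) * al `^ rho = b / a * (2 * al `^ rho) by ring.
    by rewrite ler_wpM2l ?ltW.
  by rewrite lte_fin ltr_pM2r// ltr_pM2r//; lra.
- apply: lt_le_trans (_ : _ < (a / b / 2 * al `^ rho)%:E)%E _.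
    by rewrite lte_fin ltr_pM2r//; lra.
  apply: limf_einf_ge; near=> x.
  have [xx0 xp lo _] : [/\ x0 <= x, 0 < x,
    al `^ rho / 2 < tail P X (al * x) / tail P X x &
    tail P X (al * x) / tail P X x < 2 * al `^ rho] by near: x.
  have /andP[/(le_trans _)+ _] := bounds _ xx0 xp; apply.
  have -> : a / b / 2 * al `^ rho = a / b * (al `^ rho / 2) by ring.
  by rewrite ler_wpM2l ?ltW.
Unshelve. all: by end_near. Qed.

(** * Bounds on the response time *)

(** The event where the sample-path equations hold need not be measurable; it
    only has to contain one of full measure. *)
Lemma measure_ae_le d (T : measurableType d) (R : realType) (P : probability T R)
    (G E F : set T) : measurable E -> measurable F ->
  {ae P, forall w, G w} -> (forall w, G w -> E w -> F w) -> (P E <= P F)%E.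
Proof.
move=> mE mF [Z [mZ PZ GZ]] GEF.
apply: (@le_trans _ _ (P (F `|` Z))).
  apply: le_measure; rewrite ?inE//; first exact: measurableU.
  move=> w Ew; have [Gw|nGw] := pselect (G w); first by left; exact: GEF.
  by right; exact: GZ.
apply: le_trans (measureU2 P mF mZ) _.
by rewrite [X in (_ + X)%E]PZ adde0.
Qed.

Lemma expectationE d (T : measurableType d) (R : realType) (P : probability T R)
  (X : T -> R) : ('E_P[X] = \int[P]_w (X w)%:E)%E.
Proof. by rewrite unlock. Qed.

Section response.
Context {d : measure_display} {Omega : measurableType d} {R : realType}.
Variables (P : probability Omega R) (N nF nJ : nat).
Variables (A : nat -> {RV P >-> R}) (s : nat -> Omega -> {ffun 'I_nF -> 'I_N})
  (B : nat -> {RV P >-> nF.-tuple R}) (D : nat -> {RV P >-> \bar R}).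
Hypotheses (nJ_itv : (0 < nJ <= nF)%N) (input : fork_join_input A s B).
Hypothesis coc : coc_fork_join_lcfs nJ A s B D.

Let beta := order_stat_size nJ B.
Let F := tail P (EFin \o beta 0%N).

Lemma arrival_epochB k i w :
  arrival_epoch A (k + i) w = arrival_epoch A k w + \sum_(l < i) A (k.+1 + l)%N w.
Proof.
elim: i => [|i IHi]; first by rewrite addn0 big_ord0 addr0.
rewrite addnS big_ord_recr/= addrA -IHi /arrival_epoch big_ord_recr/=.
by rewrite addSn.
Qed.

Lemma arrival_epoch_homo w : {homo (arrival_epoch A)^~ w : k l / (k <= l)%N >-> k <= l}.
Proof.
move=> k l kl; rewrite -(subnKC kl) arrival_epochB lerDl.
by apply: sumr_ge0 => i _; exact: (interarrival_ge0 input).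
Qed.

Lemma measurable_response k (x : R) :
  measurable [set w | (x%:E < response_time A D k w)%E].
Proof.
rewrite -[X in measurable X]setTI; apply: emeasurable_fun_o_infty => //.
apply: emeasurable_funB; first exact: measurable_funPT.
by apply/measurable_EFinP; apply: measurable_sum => i; exact: measurable_funPT.
Qed.

Lemma measurable_size_tail k (x : R) : measurable [set w | (x%:E < (beta k w)%:E)%E].
Proof.
rewrite -[X in measurable X]setTI; apply: emeasurable_fun_o_infty => //.
by apply/measurable_EFinP; exact: measurable_order_stat_size.
Qed.

Lemma tail_response_ge k x : F x <= tail P (response_time A D k) x.
Proof.
have mE := measurable_size_tail k x; have mF := measurable_response k x.
have -> : F x = fine (P [set w | (x%:E < (beta k w)%:E)%E]).
  have setE j : beta j @^-1` `]x, +oo[ = [set w | (x%:E < (beta j w)%:E)%E].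
    by apply/seteqP; split => w /=; rewrite in_itv/= andbT lte_fin.
  congr fine; rewrite -setE (order_stat_size_id nJ_itv input k)// setE.
  by [].
rewrite fine_le ?fin_num_measure//.
apply: (measure_ae_le mE mF coc) => w [W [servedW doneD]] /= xb.
rewrite /response_time lteBrDr//.
have /(lt_le_trans _) := completion_ge nJ_itv servedW doneD k; apply.
by rewrite -EFinD lte_fin addrC ltrD2l -lte_fin.
Qed.

(** Sample-path core of the upper bound, [busy_period] being applied at the time
    obtained from the arrival of job [k] by adding [i] rounded interarrival
    times.  The grid of service times has [n * LA + 1] points so that a single
    service time beyond its end outweighs [n] interarrival times. *)
Lemma stay_of_response (h : R) (LA n k : nat) (x : R) w :
  0 < h -> n%:R * (LA%:R * h) <= x ->
  coc_lcfs_pr nJ ((arrival_epoch A)^~ w) (s^~ w) (fun k => B k w) (fun k => D k w) ->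
  (x%:E < response_time A D k w)%E ->
  stay (@grid_step R h LA (n * LA)) n 0 (fun l => cell nJ A B h LA (n * LA) k l w).
Proof.
move=> h0 nx [W [servedW doneD]]; rewrite /response_time lteBrDr// -EFinD => xD.
apply: stayP => i ilen; rewrite add0r.
pose a l := (grid h LA (A (k.+1 + l)%N w))%:R * h.
pose v l := (grid h (n * LA) (beta (k + l)%N w)).+1%:R * h.
have -> : \sum_(l < i) grid_step h (cell nJ A B h LA (n * LA) k l w) =
    \sum_(l < i) v l - \sum_(l < i) a l by rewrite -sumrB.
have aA l : a l <= Num.min (A (k.+1 + l)%N w) (LA%:R * h).
  by apply: grid_le => //; exact: (interarrival_ge0 input).
have sum_a_le : \sum_(l < i) a l <= i%:R * (LA%:R * h).
  rewrite mulr_natl -[X in _ *+ X](card_ord i) -sumr_const.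
  by apply: ler_sum => l _; apply: le_trans (aA l) _; rewrite ge_min lexx orbT.
have Lh0 : 0 <= LA%:R * h by rewrite mulr_ge0// ltW.
have sum_a_n : \sum_(l < i) a l <= n%:R * (LA%:R * h).
  by apply: le_trans sum_a_le _; rewrite ler_wpM2r// ler_nat.
have v0 l : 0 <= v l by rewrite mulr_ge0// ltW.
have bv l : Num.min (beta (k + l)%N w) ((n * LA).+1%:R * h) <= v l.
  exact: grid_gt.
have [[l bl]|small] := pselect (exists l : 'I_i, (n * LA).+1%:R * h < beta (k + l)%N w).
  rewrite subr_ge0; apply: le_trans sum_a_n _.
  rewrite (bigD1 l)//=; apply: ler_wpDr; first by apply: sumr_ge0.
  apply: le_trans (bv l); rewrite (min_idPr _) ?(ltW bl)// mulrA -natrM.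
  by rewrite ler_wpM2r ?(ltW h0)// ler_nat.
have : \sum_(l < i) beta (k + l)%N w <= \sum_(l < i) v l.
  apply: ler_sum => l _; apply: le_trans (bv l); rewrite le_min lexx/= leNgt.
  by apply/negP => bl; apply: small; exists l.
suff : \sum_(l < i) a l <= \sum_(l < i) beta (k + l)%N w by lra.
have b0 j i' : 0 <= tnth (B j w) i' by exact: (size_ge0 input).
have := busy_period nJ_itv b0 servedW doneD (@arrival_epoch_homo w) (k := k) (i := i)
  (t := arrival_epoch A k w + \sum_(l < i) a l).
rewrite addrAC subrr add0r; apply.
  apply: le_lt_trans xD; rewrite lee_fin addrC lerD2r.
  exact: le_trans sum_a_n nx.
rewrite arrival_epochB lerD2l; apply: ler_sum => l _.
by apply: le_trans (aA l) _; rewrite ge_min lexx.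
Qed.

Lemma tail_response_le_survival (h : R) (LA n k : nat) (x : R) :
  0 < h -> n%:R * (LA%:R * h) <= x ->
  tail P (response_time A D k) x <=
  survival (grid_weight P h (A 0%N) (beta 0%N)) (@grid_step R h LA (n * LA)) n 0.
Proof.
move=> h0 nx; set w' := grid_weight _ _ _ _; set X := @grid_step _ _ _ _.
pose C := cell nJ A B h LA (n * LA) k.
have mC l (i : 'I_LA.+1 * 'I_(n * LA).+1) : measurable (C l @^-1` [set i]).
  exact: (measurable_cell A B nJ_itv k h0 l i).
have w'0 i : 0 <= w' i by rewrite mulr_ge0 ?grid_law_ge0.
have iid p : P (cylinder C p) = (\prod_(i <- p) w' i)%:E.
  exact: (cell_iid nJ_itv input k h0 p).
have := @stay_le_survival _ _ _ P _ w' X C w'0 mC iid n 0 [::].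
rewrite big_nil mul1r -lee_fin; apply: le_trans.
rewrite /tail fineK ?fin_num_measure//; last exact: measurable_response.
apply: (measure_ae_le _ _ coc).
- exact: measurable_response.
- apply: measurableI; first exact: measurable_cylinder.
  exact: (measurable_stay X mC n 0 0).
- by move=> w cw xw; split => //; exact: (stay_of_response h0 nx cw xw).
Qed.

(** Assembly of the upper bound.  The gap [gam] between the two means is spent
    on the truncation of interarrival times, [gam / 4], and on rounding,
    [2 * h = gam / 4], which leaves a drift of [- gam / 2]. *)
Lemma tail_response_le :
  ('E_P[A 0%N] < +oo)%E -> (rho_U nJ A B < 1)%E ->
  (forall x, 0 < F x) -> dominatedly_varying F ->
  exists C x0 : R, 0 < C /\
    forall k x, x0 <= x -> tail P (response_time A D k) x <= C * F x.
Proof.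
move=> Afin rho1 F0 Fdom.
have beta0 := order_stat_size_ge0 nJ_itv input 0.
have A0 := interarrival_ge0 input 0.
have mbeta : measurable_fun setT (beta 0%N) by exact: measurable_order_stat_size.
have mA : measurable_fun setT (A 0%N) by exact: measurable_funPT.
have [z Ez] : exists z : R, (\int[P]_w (A 0%N w)%:E)%E = z%:E.
  exists (fine (\int[P]_w (A 0%N w)%:E)%E); rewrite fineK// ge0_fin_numE.
    by rewrite -expectationE.
  by apply: integral_ge0 => w _; rewrite lee_fin.
(* If the interarrival times had mean zero, [rho_U] would be infinite, but only
   because the mean of [beta] is positive. *)
have Ebeta_gt0 : (0 < \int[P]_w (beta 0%N w)%:E)%E.
  have m1 := measurable_size_tail 0 1.
  apply: (@lt_le_trans _ _ (\int[P]_w (\1_[set w | (1%:E < (beta 0%N w)%:E)%E] w)%:E)%E).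
    rewrite integral_indic// setIT -[ltRHS]fineK ?fin_num_measure// lte_fin.
    exact: F0.
  apply: ge0_le_integral => //.
  - by apply/measurable_EFinP; exact: measurable_indic.
  - exact/measurable_EFinP.
  - move=> w _; rewrite lee_fin indicE; case: (asboolP ((1%:E < (beta 0%N w)%:E)%E)) => hw.
      by rewrite mem_set//= ltW// -lte_fin.
    by rewrite memNset//= beta0.
have [y [Ey yz]] : exists y : R, (\int[P]_w (beta 0%N w)%:E)%E = y%:E /\ y < z.
  have z0 : 0 <= z.
    by rewrite -lee_fin -Ez; apply: integral_ge0 => w _; rewrite lee_fin.
  move: rho1 Ebeta_gt0; rewrite /rho_U !expectationE Ez -/beta.
  case: (\int[P]_w (beta 0%N w)%:E)%E => [y| |//].
    have [->|zn0] := eqVneq z 0.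
      by rewrite inve0 lte_fin => + y0; rewrite gt0_muley ?lte_fin.
    rewrite inver (negbTE zn0) -EFinM !lte_fin => + _.
    by rewrite ltr_pdivrMr ?mul1r ?lt0r ?zn0// => yz; exists y.
  have zi : (0 < (z%:E)^-1)%E.
    have [->|zn0] := eqVneq z 0; first by rewrite inve0.
    by rewrite inver (negbTE zn0) lte_fin invr_gt0 lt0r zn0.
  by rewrite gt0_mulye.
pose gam := z - y; have gam0 : 0 < gam by rewrite subr_gt0.
pose h := gam / 8; have h0 : 0 < h by rewrite divr_gt0.
have Aoo : (\int[P]_w (A 0%N w)%:E < +oo)%E by rewrite Ez ltry.
have Boo : (\int[P]_w (beta 0%N w)%:E < +oo)%E by rewrite Ey ltry.
have gam4 : 0 < gam / 4 by rewrite divr_gt0.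
have [K K0 hK] := excess_small mA A0 Aoo gam4.
pose LA := (Num.truncn (K / h)).+1.
have KL : K <= LA%:R * h by rewrite -ler_pdivrMr// ltW// truncnS_gt.
have M0 : 0 < LA%:R * h by rewrite mulr_gt0// ltr0n.
have excA : (\int[P]_w (A 0%N w - Num.min (A 0%N w) (LA%:R * h))%:E <= (gam / 4)%:E)%E.
  apply: le_trans hK; apply: ge0_le_integral => //.
  - by move=> w _; rewrite lee_fin subr_ge0 ge_min lexx.
  - by apply/measurable_EFinP; apply: measurable_funB => //; exact: measurable_minr.
  - by apply/measurable_EFinP; apply: measurable_funB => //; exact: measurable_minr.
  - by move=> w _; rewrite lee_fin lerB// le_min !ge_min lexx/= KL orbT.
have /choice[kappa kappaP] : forall e : R, exists k : R, 0 <= k /\ (0 < e ->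
    (\int[P]_w (beta 0%N w - Num.min (beta 0%N w) k)%:E <= e%:E)%E).
  move=> e; have [e0|e0] := ltP 0 e; last by exists 0; split.
  have [k k0 hk] := excess_small mbeta beta0 Boo e0.
  by exists k.
have walk LB := @uniform_grid_walk _ _ _ P h h0 LA LB _ _ kappa _ _ _ mA mbeta A0 beta0 Ez Ey excA (fun e => (kappaP e).2).
have mu0 : 0 < z - gam / 4 - y - 2 * h by rewrite /h /gam; move: gam0; rewrite /gam; lra.
have kh0 e : 0 <= kappa e + h by rewrite addr_ge0 ?(kappaP e).1// ltW.
have Fmono : {homo F : x y / x <= y >-> y <= x}.
  by apply: tail_nonincreasing; exact/measurable_EFinP.
have [C C0 hC] := survival_dominated (2 * h) (ltW M0) mu0 kh0 F0 Fmono Fdom.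
have c0 : 0 < (2 * (LA%:R * h))^-1 by rewrite invr_gt0 mulr_gt0.
have [K1 [x1 [K10 hK1]]] := Fdom _ c0.
exists (C * K1), (Num.max x1 (2 * (LA%:R * h))); split; first by rewrite mulr_gt0.
move=> k x; rewrite ge_max => /andP[x1x Mx].
pose n := Num.truncn (x / (LA%:R * h)).
have xM0 : 0 <= x / (LA%:R * h) by rewrite divr_ge0 ?(ltW M0)//; lra.
have nx : n%:R * (LA%:R * h) <= x by rewrite -ler_pdivlMr// truncn_le.
apply: le_trans (tail_response_le_survival k h0 nx) _.
apply: le_trans (hC _ _ _ (walk _) n) _.
rewrite -mulrA ler_wpM2l ?(ltW C0)//; apply: le_trans (hK1 _ x1x); apply: Fmono.
have xMn : x / (LA%:R * h) < n%:R + 1 by rewrite natr1; exact: truncnS_gt.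
have xM2 : 2 <= x / (LA%:R * h) by rewrite ler_pdivlMr.
have -> : (2 * (LA%:R * h))^-1 * x = (x / (LA%:R * h)) / 2.
  by rewrite invfM mulrC mulrCA mulrC.
lra.
Qed.

End response.

Theorem theorem3 (R : realType) (d : measure_display) (Omega : measurableType d)
  (P : probability Omega R) (N nF nJ : nat)
  (A : nat -> {RV P >-> R})
  (s : nat -> Omega -> {ffun 'I_nF -> 'I_N})
  (B : nat -> {RV P >-> (nF.-tuple R)})
  (D : nat -> {RV P >-> \bar R})
  (d' : measure_display) (Omega' : measurableType d') (Q : probability Omega' R)
  (Rss : {RV Q >-> \bar R}) (nu : R) :
  (1 <= nJ)%N -> (nJ <= nF)%N -> (nF <= N)%N ->
  fork_join_input A s B ->
  ('E_P[A 0%N] < +oo)%E ->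
  coc_fork_join_lcfs nJ A s B D ->
  converges_in_distribution P (response_time A D) Q Rss ->
  (rho_U nJ A B < 1)%E ->
  regularly_varying P (EFin \o order_stat_size nJ B 0%N) (- nu)%R ->
  O_regularly_varying Q Rss (- nu)%R.
Proof.
move=> nJ1 nJF _ input Afin coc cvgR rho1 rvB.
have nJ_itv : (0 < nJ <= nF)%N by rewrite nJ1.
pose F := tail P (EFin \o order_stat_size nJ B 0%N).
have mB : measurable_fun setT (EFin \o order_stat_size nJ B 0%N).
  by apply/measurable_EFinP; exact: measurable_order_stat_size.
have F0 : forall x, 0 < F x := tail_gt0 mB rvB.
have Fdom : dominatedly_varying F := tail_dominatedly_varying mB rvB.
have Fmono : {homo F : x y / x <= y >-> y <= x} := tail_nonincreasing P mB.
have Gmono : {homo tail Q Rss : x y / x <= y >-> y <= x}.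
  by apply: tail_nonincreasing; exact: measurable_funPT.
have [C [x0 [C0 hC]]] := tail_response_le nJ_itv input coc Afin rho1 F0 Fdom.
have half0 : 0 < 2^-1 :> R by [].
have [K [x1 [K0 hK]]] := Fdom _ half0.
have lim_le x : x0 <= x -> {for x, continuous (tail Q Rss)} -> F x <= tail Q Rss x <= C * F x.
  move=> xx0 /cvgR cx; apply/andP; split.
    apply: (cvgr_to_ge cx); apply: nearW => k.
    exact: (tail_response_ge nJ_itv input coc).
  by apply: (cvgr_to_le cx); apply: nearW => k; exact: hC.
apply: (@O_regularly_varying_sandwich _ _ _ _ _ _ _ _ _ _ K^-1 (C * K)
  (Num.max 1 (Num.max x1 (2 * x0))) mB rvB).
- by rewrite invr_gt0.
- by rewrite mulr_gt0.
move=> x; rewrite !ge_max => /and3P[x1' x1x x0x].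
apply/andP; split.
  have [y /andP[xy y2x] cy] : exists2 y, x < y < 2 * x & {for y, continuous (tail Q Rss)}.
    by apply: nonincreasing_continuity_point Gmono _; lra.
  have yx0 : x0 <= y by lra.
  have /andP[Fy _] := lim_le _ yx0 cy.
  apply: le_trans (_ : F y <= _); last by apply: le_trans Fy _; apply: Gmono; exact: ltW.
  rewrite ler_pdivrMl//.
  have Fx : F x <= K * F (2 * x).
    by have := hK (2 * x); rewrite mulrA mulVf// mul1r; apply; lra.
  apply: le_trans Fx _.
  by rewrite ler_wpM2l ?(ltW K0)//; apply: Fmono; exact: ltW.
have [y /andP[xy y2x] cy] : exists2 y, 2^-1 * x < y < x & {for y, continuous (tail Q Rss)}.
  by apply: nonincreasing_continuity_point Gmono _; lra.
have yx0 : x0 <= y by lra.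
have /andP[_ Gy] := lim_le _ yx0 cy.
apply: le_trans (_ : tail Q Rss y <= _); first by apply: Gmono; exact: ltW.
apply: le_trans Gy _; rewrite -mulrA ler_wpM2l ?(ltW C0)//.
apply: le_trans (hK _ x1x); apply: Fmono; exact: ltW.
Qed.
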